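(* With the notation of the context (and identifying each partition $\lambda$ with the word $w(\lambda)$), Foata's fundamental bijection $\phi$ satisfies $$\phi^{-1}(P)=W_{21},\qquad \phi^{-1}(R_{\ge1}')=B_{21},\qquad \phi^{-1}(P_{\neq1}')=W_{121}.$$ It follows that $(S,T)=(W_{21},P)$, $(B_{21},R_{\ge1}')$, and $(W_{121},P_{\neq1}')$ are Mahonian pairs. Furthermore, for any of these three pairs $(S,T)$ we have $$\sum_{v\in S}q^{\operatorname{maj} v}t^{\operatorname{des} v}z^{e(v)}=\sum_{\lambda\in T}q^{|\lambda|}t^{d(\lambda)}z^{r(\lambda)+1}$$ (an identity of formal series in which exponents of $z$ may be negative). We also have $$\sum_{w\in B_{21}}q^{\operatorname{maj} w}=\sum_{w\in W_{121}}q^{\operatorname{maj} w}=\prod_{i\ge2}\frac1{1-q^i}.$$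
   Context: $\mathbb P^*$ is the set of all finite words in the positive integers, $\epsilon$ the empty word. For $w=a_1\ldots a_n$: $\operatorname{Des} w=\{i: 1\le i<n,\ a_i>a_{i+1}\}$, $\operatorname{des} w=|\operatorname{Des} w|$, $\operatorname{maj} w=\sum_{i\in\operatorname{Des} w} i$, $\operatorname{inv} w=|\{(i,j): i<j,\ a_i>a_j\}|$. For $S,T\subseteq\mathbb P^*$ of any cardinality, $(S,T)$ is a Mahonian pair if there is a bijection $\alpha:S\to T$ with $\operatorname{maj} v=\operatorname{inv}\alpha(v)$ for all $v\in S$. Foata's fundamental bijection $\phi:\mathbb P^*\to\mathbb P^*$: $\phi(\epsilon)=\epsilon$. For $v=a_1\ldots a_n$ with $n\ge1$, define $w_1=a_1$ and, given $w_i=b_1\ldots b_i$, define $w_{i+1}$ as follows. If $b_i\le a_{i+1}$ (respectively $b_i>a_{i+1}$), factor $w_i=f_1f_2\cdots f_k$ uniquely so that in each factor every letter is $>a_{i+1}$ (respectively $\le a_{i+1}$) except its last letter, which is $\le a_{i+1}$ (respectively $>a_{i+1}$). Let $g_j$ be obtained from $f_j$ by moving its last letter to the front, and set $w_{i+1}=g_1g_2\cdots g_k\,a_{i+1}$. Then $\phi(v)=w_n$. It is known that $\phi$ is a bijection preserving the multiset of letters and that $\operatorname{maj} v=\operatorname{inv}\phi(v)$. Words: a word in $\{1,2\}^*$ is a ballot sequence if every prefix contains at least as many ones as twos. For a word $u$, $W_u=\{xu: x\in\{1,2\}^*\}\cup\{\epsilon\}$ and $B_u=\{w\in W_u: w\text{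 is a ballot sequence}\}$. Every $v\in\{1,2\}^*$ with exactly $d$ descents is uniquely $v=1^{m_0}2^{n_0}\cdots1^{m_d}2^{n_d}$ with $m_0,n_d\ge0$ and all other $m_i,n_j>0$; set $e_i(v)=n_0+\cdots+n_i-m_0-\cdots-m_i$ and $e(v)=\max_{0\le i\le d}e_i(v)$ (so $e(\epsilon)=0$). Partitions: $P$ is the set of all integer partitions (including the empty one). For $\lambda\in P$, $|\lambda|$ is the sum of the parts, $\lambda'$ the conjugate, $d(\lambda)$ the side length of the Durfee square (largest $d\times d$ square in the Ferrers diagram), $r_i(\lambda)=\lambda_i-\lambda_i'$ for $1\le i\le d(\lambda)$, and $r(\lambda)=\max_{1\le i\le d(\lambda)}r_i(\lambda)$, with the convention $r(\emptyset)=-1$ for the empty partition. $R_{\ge1}=\{\lambda\in P: r_i(\lambda)\ge1\text{ for all }1\le i\le d(\lambda)\}$; $P_{\neq1}=\{\lambda\in P: \lambda_i\ne1\text{ for all }i\}$; for a set $\Lambda$ of partitions, $\Lambda'=\{\lambda': \lambda\in\Lambda\}$. Each $\lambda=(\lambda_1\ge\cdots\ge\lambda_k>0)$ is identified with the word $w(\lambda)=2^{\lambda_k}\,1\,2^{\lambda_{k-1}-\lambda_k}\,1\cdots2^{\lambda_1-\lambda_2}\,1$, which records the north ($1$) and east ($2$) steps along the southeast boundary of the Ferrers diagram from its lower left to its upper right end; the empty partition corresponds to $\epsilon$. Sets of partitions are thereby regarded as subsets of $\mathbb P^*$. *)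

(* Defs.v *)
From HB Require Import structures.
From mathcomp Require Import all_boot all_order all_algebra.
From mathcomp Require Import all_classical.

Set Implicit Arguments.
Unset Strict Implicit.
Unset Printing Implicit Defensive.

Import Order.TTheory GRing.Theory Num.Theory.

Local Open Scope classical_set_scope.
Local Open Scope nat_scope.

(* Words are sequences of naturals; the set [Pstar] singles out those whose
   letters are positive.  Positions are 1-based: [letter w i] is a_i. *)
Notation word := (seq nat).

Definition Pstar : set word := [set w | all (leq 1) w].

Definition letter (w : word) (i : nat) : nat := nth 0 w i.-1.

Definition Des (w : word) : seq nat :=
  [seq i <- index_iota 1 (size w) | letter w i > letter w i.+1].

Definition des (w : word) : nat := size (Des w).

Definition maj (w : word) : nat := \sum_(i <- Des w) i.

Definition inv (w : word) : nat :=
  #|[pred p : 'I_(size w) * 'I_(size w) |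
      (p.1 < p.2) && (nth 0 w p.1 > nth 0 w p.2)]|.

Definition mahonian_pair (S T : set word) : Prop :=
  [/\ S `<=` Pstar, T `<=` Pstar &
      exists2 alpha : word -> word,
        set_bij S T alpha & forall v, S v -> maj v = inv (alpha v)].

(* The factorization f_1 ... f_k, for p the property required of the last
   letter of each factor; see [factorsK] and [factorsP]. *)
Fixpoint factors (p : pred nat) (w : word) : seq word :=
  if w is x :: w' then
    if p x then [:: x] :: factors p w'
    else if factors p w' is f :: fs then (x :: f) :: fs else [:: [:: x]]
  else [::].

(* w_(i+1) from w_i = w and a_(i+1) = a; [rotr 1] moves the last letter of a
   word to the front.  For w = [::] the result is [:: a]. *)
Definition foata_step (w : word) (a : nat) : word :=
  let p := if last 0 w <= a then (fun x => x <= a) else (fun x => a < x) in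
  rcons (flatten [seq rotr 1 f | f <- factors p w]) a.

Definition foata (v : word) : word := foldl foata_step [::] v.

Lemma factorsK p w : flatten (factors p w) = w.
Proof.
elim: w => //= x w IH; case: (p x) => /=; first by rewrite IH.
by case: (factors p w) IH => [|f fs] /= <-.
Qed.

Lemma factorsP (p : pred nat) x w : p (last x w) ->
  all (fun f => if f is y :: f' then
                  p (last y f') && all (predC p) (belast y f')
                else false) (factors p (x :: w)).
Proof.
elim: w x => [|y w IH] x; first by rewrite /= => px; rewrite px /= px.
move=> /(IH y) {IH}IH.
have -> : factors p (x :: y :: w) =
  if p x then [:: x] :: factors p (y :: w)
  else if factors p (y :: w) is f :: fs then (x :: f) :: fs
       else [:: [:: x]] by [].
case: (boolP (p x)) => px; first by rewrite /= in IH *; rewrite px IH.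
case E: (factors p (y :: w)) IH => [|[|z f] fs] //=.
  by move: (factorsK p (y :: w)); rewrite E.
by rewrite px.
Qed.

Definition binary : pred word := all (fun a => (a == 1) || (a == 2)).

Definition ballot (w : word) : Prop :=
  forall k, count_mem 2 (take k w) <= count_mem 1 (take k w).

Definition W (u : word) : set word :=
  [set w | exists2 x, binary x & w = x ++ u] `|` [set [::]].

Definition B (u : word) : set word := W u `&` [set w | ballot w].

(* The pairs (m_0, n_0), ..., (m_d, n_d) with
   v = 1^{m_0} 2^{n_0} ... 1^{m_d} 2^{n_d}; see [blocksK], [size_blocks] and
   [blocks_pos].  Only meaningful on binary words. *)
Definition blocks (v : word) : seq (nat * nat) :=
  foldr (fun a s =>
           let: (m, n) := head (0, 0) s in
           if a == 1 then (m.+1, n) :: behead s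
           else if m == 0 then (0, n.+1) :: behead s
           else (0, 1) :: s)
        [:: (0, 0)] v.

Lemma blocks_cons v : exists m n s, blocks v = (m, n) :: s.
Proof.
elim: v => [|a v [m [n [s IH]]]]; first by exists 0, 0, [::].
rewrite /= -/(blocks v) IH /=.
by case: (a == 1); [|case: (m == 0)]; do 3 eexists.
Qed.

Lemma blocksK v : binary v ->
  flatten [seq nseq b.1 1 ++ nseq b.2 2 | b <- blocks v] = v.
Proof.
elim: v => //= a v IH /andP[a12 /IH {IH}]; rewrite -/(blocks v).
have [m [n [s ->]]] := blocks_cons v.
case/orP: a12 => /eqP -> /=; first by move=> <-.
by case: m => [|m] /= <-.
Qed.

Lemma blocks_pos v :
  (forall i, 0 < i < size (blocks v) -> 0 < (nth (0, 0) (blocks v) i).1) /\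
  (forall i, i.+1 < size (blocks v) -> 0 < (nth (0, 0) (blocks v) i).2).
Proof.
elim: v => [|a v [IH1 IH2]]; first by split => [[|i]|[|i]].
rewrite /= -/(blocks v).
have [m [n [s E]]] := blocks_cons v; rewrite E /= in IH1 IH2 *.
case: (a == 1); last case: (posnP m) => [m0|m0] /=.
- by split => [[|i] //|[|i]] H; [apply: (IH1 i.+1)|apply: (IH2 0)|apply: (IH2 i.+1)].
- by split => [[|i] //|[|i]] H //; [apply: (IH1 i.+1)|apply: (IH2 i.+1)].
- by split => [[|[|i]] //|[|i]] H //; [apply: (IH1 i.+1)|apply: (IH2 i)].
Qed.

Lemma des_cons2 a b v : des [:: a, b & v] = (b < a) + des (b :: v).
Proof.
rewrite /des /Des /index_iota !size_filter /=; congr (_ + _).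
rewrite ?subn1 /=  -[2]/(1 + 1)%N iotaDl count_map.
by apply: eq_in_count => -[|i] //; rewrite mem_iota.
Qed.

Lemma size_blocks v : binary v -> size (blocks v) = (des v).+1.
Proof.
have bl1 w : binary w ->
    ((head (0, 0) (blocks w)).1 == 0) = (head 2 w == 2).
  case: w => //= b w /andP[b12 _]; rewrite -/(blocks w).
  have [m [n [s ->]]] := blocks_cons w.
  by case/orP: b12 => /eqP -> //=; case: (m == 0).
elim: v => //= a [|b v] IH /andP[a12 bv].
  by case/orP: a12 => /eqP ->.
rewrite des_cons2 -addnS -(IH bv).
move: (bl1 _ bv); rewrite -/(blocks (b :: v)).
have [m [n [s ->]]] := blocks_cons (b :: v) => /= ->.
case/andP: bv => b12 _.
by case/orP: a12 => /eqP -> /=; case/orP: b12 => /eqP ->.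
Qed.

Definition e_ (v : word) (i : nat) : int :=
  (\sum_(0 <= j < i.+1) ((nth (0, 0) (blocks v) j).2%:Z -
                         (nth (0, 0) (blocks v) j).1%:Z))%R.

Definition e (v : word) : int :=
  \big[Order.max/e_ v 0]_(0 <= i < (des v).+1) e_ v i.

(* A partition is the weakly decreasing sequence of its (positive) parts. *)
Definition P : set (seq nat) :=
  [set la | sorted geq la && all (leq 1) la].

(* lambda_i, with i counted from 1 *)
Definition part (la : seq nat) (i : nat) : nat := nth 0 la i.-1.

Definition conjugate (la : seq nat) : seq nat :=
  [seq count (leq j) la | j <- index_iota 1 (part la 1).+1].

Definition durfee (la : seq nat) : nat :=
  \max_(d < (size la).+1 | all (leq d) (take d la)) d.

Definition r_ (la : seq nat) (i : nat) : int :=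
  ((part la i)%:Z - (part (conjugate la) i)%:Z)%R.

Definition r (la : seq nat) : int :=
  if la is [::] then (-1)%R
  else \big[Order.max/r_ la 1]_(1 <= i < (durfee la).+1) r_ la i.

Definition R_ge1 : set (seq nat) :=
  [set la | P la /\ forall i, 1 <= i <= durfee la -> (1 <= r_ la i)%R].

Definition P_neq1 : set (seq nat) :=
  [set la | P la /\ 1 \notin la].

Definition conj_set (L : set (seq nat)) : set (seq nat) := conjugate @` L.

Fixpoint pword (la : seq nat) : word :=
  if la is p :: la' then pword la' ++ nseq (p - head 0 la') 2 ++ [:: 1]
  else [::].

Definition words_of (L : set (seq nat)) : set word := pword @` L.

Section FormalSums.
Variables (X : eqType) (T : choiceType).
Implicit Types (S : set T) (f : T -> X -> int).

(* A formal series is given by its coefficients, indexed by a set X of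
   exponents (exponents may be negative). *)
Definition monomial (x : X) : X -> int := fun y => ((y == x)%:R)%R.

Definition formally_summable S f : Prop :=
  forall x, finite_set (S `&` [set v | f v x != 0%R]).

(* [\sum_(v \in S) _] is the sum of a finitely supported family; this is the
   intended sum when [formally_summable S f]. *)
Definition formal_sum S f : X -> int := fun x => (\sum_(v \in S) f v x)%R.

End FormalSums.

Record fps := Fps { coef : nat -> int }.

HB.instance Definition _ := gen_eqMixin fps.
HB.instance Definition _ := gen_choiceMixin fps.

Section FpsRing.
Local Open Scope ring_scope.
Implicit Types f g h : fps.

Lemma fpsP f g : coef f =1 coef g <-> f = g.
Proof.
split=> [|-> //]; case: f g => [a] [b] /= ab; congr Fps.
exact/funext.
Qed.

Definition fps_add f g := Fps (fun n => coef f n + coef g n).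
Definition fps_opp f := Fps (fun n => - coef f n).
Definition fps_zero := Fps (fun=> 0).
Definition fps_one := Fps (fun n => (n == 0%N)%:R).
Definition fps_mul f g :=
  Fps (fun n => \sum_(i < n.+1) coef f i * coef g (n - i)).

Fact fps_addA : associative fps_add.
Proof. by move=> f g h; apply/fpsP => n /=; rewrite addrA. Qed.
Fact fps_addC : commutative fps_add.
Proof. by move=> f g; apply/fpsP => n /=; rewrite addrC. Qed.
Fact fps_add0 : left_id fps_zero fps_add.
Proof. by move=> f; apply/fpsP => n /=; rewrite add0r. Qed.
Fact fps_addN : left_inverse fps_zero fps_opp fps_add.
Proof. by move=> f; apply/fpsP => n /=; rewrite addNr. Qed.

HB.instance Definition _ :=
  GRing.isZmodule.Build fps fps_addA fps_addC fps_add0 fps_addN.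

Definition fps_trunc N f : {poly int} := \poly_(i < N) coef f i.

Fact coef_fps_mul N f g n : (n < N)%N ->
  coef (fps_mul f g) n = (fps_trunc N f * fps_trunc N g)`_n.
Proof.
move=> nN; rewrite coefM; apply: eq_bigr => i _; rewrite !coef_poly.
rewrite (leq_ltn_trans _ nN) ?(leq_ltn_trans (leq_subr _ _) nN) //.
by rewrite -ltnS ltn_ord.
Qed.

Fact fps_mulC : commutative fps_mul.
Proof.
by move=> f g; apply/fpsP => n; rewrite !(@coef_fps_mul n.+1) // mulrC.
Qed.
Fact fps_mulA : associative fps_mul.
Proof.
move=> f g h; apply/fpsP => n; rewrite !(@coef_fps_mul n.+1) //.
have E (f1 g1 : fps) i : (i < n.+1)%N ->
    (fps_trunc n.+1 (fps_mul f1 g1))`_i =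
    (fps_trunc n.+1 f1 * fps_trunc n.+1 g1)`_i.
  by move=> lt_i; rewrite coef_poly lt_i (@coef_fps_mul n.+1).
transitivity ((fps_trunc n.+1 f * (fps_trunc n.+1 g * fps_trunc n.+1 h))`_n).
  rewrite !coefM; apply: eq_bigr => i _.
  by rewrite E // ltnS leq_subr.
by rewrite mulrA !coefM; apply: eq_bigr => i _; rewrite E.
Qed.
Fact fps_mul1 : left_id fps_one fps_mul.
Proof.
move=> f; apply/fpsP => n /=; rewrite big_ord_recl /= mul1r subn0.
by rewrite big1 ?addr0 // => i _; rewrite mul0r.
Qed.
Fact fps_mulDl : left_distributive fps_mul fps_add.
Proof.
move=> f g h; apply/fpsP => n /=; rewrite -big_split /=.
by apply: eq_bigr => i _; rewrite mulrDl.
Qed.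
Fact fps_one_neq0 : fps_one != 0.
Proof. by apply/eqP => /fpsP /(_ 0%N). Qed.

HB.instance Definition _ :=
  GRing.Zmodule_isComNzRing.Build fps
    fps_mulA fps_mulC fps_mul1 fps_mulDl fps_one_neq0.

(* Invertibility and the inverse are given by their defining property. *)
Definition fps_unit : {pred fps} := [pred f | `[< exists g, g * f = 1 >]].
Definition fps_inv f : fps := xget f [set g | g * f = 1].

Fact fps_mulV : {in fps_unit, left_inverse 1 fps_inv *%R}.
Proof.
move=> f /asboolP[g gf].
exact: (@xgetPex _ f [set h | h * f = 1] (ex_intro _ g gf)).
Qed.
Fact fps_unitP f g : g * f = 1 -> fps_unit f.
Proof. by move=> gf; apply/asboolP; exists g. Qed.
Fact fps_inv_out : {in [predC fps_unit], fps_inv =1 id}.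
Proof.
move=> f /asboolPn nf.
by rewrite /fps_inv; case: xgetP => // h _ hf; case: nf; exists h.
Qed.

HB.instance Definition _ :=
  GRing.ComNzRing_hasMulInverse.Build fps fps_mulV fps_unitP fps_inv_out.

Definition qX (n : nat) : fps := Fps (monomial n).

Lemma unit_one_sub_qX i : (0 < i)%N -> 1 - qX i \is a GRing.unit.
Proof.
move=> i0; apply/asboolP; exists (Fps (fun n => (i %| n)%:R)).
rewrite mulrC; apply/fpsP => n.
have -> : coef ((1 - qX i) * Fps (fun m => (i %| m)%:R)) n =
    \sum_(j < n.+1) ((j == 0 :> nat)%:R - (j == i :> nat)%:R)
                    * (i %| n - j)%:R :> int by [].
under eq_bigr do rewrite mulrBl.
have E0 : \sum_(j < n.+1) (j == 0 :> nat)%:R * (i %| n - j)%:R =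
          (i %| n)%:R :> int.
  rewrite big_ord_recl /= mul1r subn0 big1 ?addr0 // => j _.
  by rewrite mul0r.
rewrite sumrB {}E0.
have [ni|le_in] := ltnP n i.
  rewrite big1 => [|j _]; last by rewrite ltn_eqF ?mul0r // (leq_trans _ ni).
  rewrite subr0; case: n ni => [|n] ni; first by rewrite dvdn0.
  by rewrite gtnNdvd.
rewrite (bigD1 (Ordinal (le_in : (i < n.+1)%N))) //= eqxx mul1r.
rewrite big1 ?addr0 => [|j nj]; last first.
  by rewrite -val_eqE /= in nj; rewrite (negbTE nj) mul0r.
rewrite dvdn_subl // subrr; case: n le_in => // le_in.
by rewrite leqNgt i0 in le_in.
Qed.

(* prod_{i >= a} F i = f : the coefficients of the partial products are
   eventually constant, equal to those of f. *)
Definition infinite_prod (a : nat) (F : nat -> fps) (f : fps) : Prop :=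
  forall n, exists N, forall M, (N <= M)%N ->
    coef (\prod_(a <= i < M) F i) n = coef f n.

End FpsRing.

(* Main.v *)
From mathcomp Require Import all_boot all_order all_algebra.
From mathcomp Require Import all_classical zify ring.
Require Import Defs.

(** On words in the letters 1 and 2, Foata's bijection has a simple recursion:
    with [b] the last letter of [phi(v) = u b],
      phi(v 2) = phi(v) 2,  phi(v 1) = b u 1,  hence phi(x 2 1) = 2 phi(x) 1.
    Since [phi] keeps the last letter, a nonempty image starts with 2 and ends
    with 1 exactly when its argument ends with 21. The words that start with 2
    and end with 1 are the words of nonempty partitions, which gives
    phi^-1(P) = W_21.

    The other two equalities and the joint distribution come from one
    observation. Read a binary word as a partition by recording, for each 1,
    the number of 2s before it ([rows]). Passing from [u] to [2 u 1] adds a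
    hook around the partition of [u]: a first row with one cell for every 2 of
    [u], a first column with one cell for every 1 of [u], and a corner. So the
    Durfee square grows by one and a new first rank #2(u) - #1(u) is put in
    front of the old ranks. On the side of [v = x 2 1], a descent is added,
    and the path of [v], with step +1 for a 2 and -1 for a 1, has a new last
    peak of height #2(x) - #1(x) + 1. The new descent is at the place
    [size x + 1], the number of cells of the hook for [u = phi(x)], so maj
    becomes the size of the partition ([maj_foata]), which is the number of
    inversions of its word ([inv_rows]). The recursion for [phi] therefore turns
    the heights of the peaks of [v], read from right to left, into the
    successive ranks of [phi(v)] plus one ([ranks_foata]). Three consequences
    follow: des becomes the side of the Durfee square, [e] (the highest peak)
    becomes r + 1, and [v] is a ballot sequence (no peak above 0) exactly when
    all the ranks are at most -1, that is, when the conjugate has ranks at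
    least 1. The last case only needs the last two letters of the word: the
    conjugate of a partition has no part 1 when the two largest parts are
    equal, that is, when phi(x 2 1) = 2 phi(x) 1 ends with 11, that is, when
    [x] ends with 1.

    For the product, B_21 and W_121 are both shown to have the generating
    function (1 - q) sum_{W_21} q^maj, by two bijections from W_21 to the
    complements of these sets in W_21, each of which raises maj by 1. For
    W_121 it is the insertion of a 2 before the final 21. For B_21
    it is the usual path surgery: replace by a 2 the step 1 that follows the
    last visit to the maximal height ([raise_bij]). To make sense of these
    bijections at the end of the word, elements of W_21 are treated as infinite
    words ending with 1s, whose canonical forms are the words not ending with
    1 ([trimmed]). Finally, the sum over W_121 counts the partitions with no
    part 1, which are counted by recursion on a bound for the largest part. *)

Set Implicit Arguments.
Unset Strict Implicit.
Unset Printing Implicit Defensive.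

Import Order.TTheory GRing.Theory Num.Theory.

Local Open Scope classical_set_scope.
Local Open Scope nat_scope.

(** * Foata's bijection on binary words *)

Lemma binary_cons a w : binary (a :: w) = ((a == 1) || (a == 2)) && binary w.
Proof. by []. Qed.

Lemma binary_cat u w : binary (u ++ w) = binary u && binary w.
Proof. exact: all_cat. Qed.

Lemma binary_nseq2 n : binary (nseq n 2).
Proof. by rewrite /binary all_nseq orbT. Qed.

Lemma binary_rcons w a : binary (rcons w a) = ((a == 1) || (a == 2)) && binary w.
Proof. exact: all_rcons. Qed.

Lemma binary_snoc_ind (Q : word -> Prop) :
  Q [::] ->
  (forall w, binary w -> Q w -> Q (rcons w 1)) ->
  (forall w, binary w -> Q w -> Q (rcons w 2)) ->
  forall w, binary w -> Q w.
Proof.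
move=> Q0 Q1 Q2; elim/last_ind => // w a IH.
by rewrite binary_rcons => /andP[/orP[]/eqP-> bw]; [apply: Q1|apply: Q2]; auto.
Qed.

Lemma binary_positive w : binary w -> Pstar w.
Proof. by apply: sub_all => a /orP[]/eqP->. Qed.

Lemma binary_size w : binary w -> count_mem 2 w + count_mem 1 w = size w.
Proof. by elim: w => //= a w IH /andP[/orP[]/eqP-> /IH <-] /=; lia. Qed.

Lemma perm_flatten_rotr (fs : seq word) :
  perm_eq (flatten [seq rotr 1 f | f <- fs]) (flatten fs).
Proof. by elim: fs => //= f fs IH; apply: perm_cat => //; rewrite perm_rotr. Qed.

Lemma perm_foata v : perm_eq (foata v) v.
Proof.
elim/last_ind: v => // v a IH.
rewrite /foata foldl_rcons -/(foata v) /foata_step.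
rewrite -!cats1 perm_cat2r (permPl (perm_flatten_rotr _)) factorsK //.
Qed.

Lemma factors_neq0 p w : all (fun f => f != [::]) (factors p w).
Proof.
elim: w => //= x w; case: (p x) => //=.
by case: (factors p w) => //= f fs /andP[].
Qed.

Lemma rotr1_rcons (T : Type) (s : seq T) x : rotr 1 (rcons s x) = x :: s.
Proof. by rewrite /rotr size_rcons subn1 /= -cats1 rot_size_cat. Qed.

(** When the factors are cut after each occurrence of a single letter [b],
    moving the last letter of every factor to the front amounts to one cyclic
    rotation of the whole word. *)
Lemma rotate_factors (p : pred nat) b u :
  p b -> all (fun x => p x ==> (x == b)) u ->
  flatten [seq rotr 1 f | f <- factors p (rcons u b)] = b :: u.
Proof.
move=> pb; elim: u => [|x u IH] /= => [_|/andP[px /IH {}IH]]; first by rewrite pb.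
case: ifP px => [_ /= /eqP->|_ _]; first by rewrite IH.
move: IH (factors_neq0 p (rcons u b)) => {pb}.
case: (factors p _) => // f fs; elim/last_ind: f => // f c _ + _.
by rewrite /= -rcons_cons !rotr1_rcons /= => -[-> ->].
Qed.

Lemma rotate_factors_all (p : pred nat) w : all p w ->
  flatten [seq rotr 1 f | f <- factors p w] = w.
Proof. by elim: w => //= x w IH /andP[-> /IH] /= ->. Qed.

Lemma binary_foata v : binary (foata v) = binary v.
Proof. exact: perm_all (perm_foata v). Qed.

Lemma foata_rcons2 v : binary v -> foata (rcons v 2) = rcons (foata v) 2.
Proof.
rewrite -binary_foata /foata foldl_rcons -/(foata v).
move: (foata v) => w bw; have w2 : all (fun x => x <= 2) w.
  by apply: sub_all bw => x /orP[]/eqP->.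
rewrite /foata_step; case: ifP => [_|]; first by rewrite rotate_factors_all.
by case/lastP: w w2 {bw} => // w a; rewrite all_rcons last_rcons => /andP[->].
Qed.

Lemma foata_rcons1 v : binary v -> foata (rcons v 1) = rcons (rotr 1 (foata v)) 1.
Proof.
rewrite -binary_foata /foata foldl_rcons -/(foata v).
move: (foata v) => w; case/lastP: w => // w a.
rewrite binary_rcons /foata_step last_rcons rotr1_rcons => /andP[a12 bw].
rewrite rotate_factors //; first by case/orP: a12 => /eqP ->.
by apply: sub_all bw => x; case/orP: a12 => /eqP -> /orP[]/eqP->.
Qed.

Lemma foata_rcons21 x : binary x ->
  foata (rcons (rcons x 2) 1) = 2 :: rcons (foata x) 1.
Proof.
move=> bx; rewrite foata_rcons1 ?binary_rcons //=.
by rewrite foata_rcons2 // rotr1_rcons.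
Qed.

Lemma last_foata x v : last x (foata v) = last x v.
Proof.
by case/lastP: v => // v a; rewrite /foata foldl_rcons /foata_step !last_rcons.
Qed.

Lemma foata_inj v v' : binary v -> foata v = foata v' -> v = v'.
Proof.
have sz u : size (foata u) = size u := perm_size (perm_foata u).
move=> bv; move: v bv v'; apply: binary_snoc_ind.
- by move=> v' /(congr1 size); rewrite !sz; case: v'.
- move=> v bv IH v' E; have bv' : binary v'.
    by rewrite -binary_foata -E binary_foata binary_rcons.
  have /esym L := congr1 (last 0) E; case/lastP: v' => [|v' a] in E L bv' *.
    by move/(congr1 size): E; rewrite !sz size_rcons.
  move: L bv' E; rewrite !last_foata !last_rcons binary_rcons => -> /andP[_ bv'].
  rewrite !foata_rcons1 // => /rcons_inj[] /(can_inj (@rotrK 1 _)).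
  by move/IH->.
- move=> v bv IH v' E; have bv' : binary v'.
    by rewrite -binary_foata -E binary_foata binary_rcons.
  have /esym L := congr1 (last 0) E; case/lastP: v' => [|v' a] in E L bv' *.
    by move/(congr1 size): E; rewrite !sz size_rcons.
  move: L bv' E; rewrite !last_foata !last_rcons binary_rcons => -> /andP[_ bv'].
  by rewrite !foata_rcons2 // => /rcons_inj[] /IH->.
Qed.

Lemma foata_surj w : binary w -> exists2 v, binary v & foata v = w.
Proof.
have [n] := ubnP (size w); elim: n w => // n IH w.
case/lastP: w => [_ _|w a]; first by exists [::].
rewrite size_rcons ltnS binary_rcons => sw /andP[/orP[]/eqP-> bw].
  case: (IH (rot 1 w)) => [||v bv E]; first by rewrite size_rot.
    by rewrite /binary (perm_all _ (permEl (perm_rot 1 w))).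
  by exists (rcons v 1); rewrite ?binary_rcons // foata_rcons1 // E rotK.
case: (IH w) => // v bv E.
by exists (rcons v 2); rewrite ?binary_rcons // foata_rcons2 // E.
Qed.

(** * Binary words as partitions *)

(** For each letter 1, from right to left, the number of letters 2 before it:
    the rows, from top to bottom, of the diagram below the lattice path. An
    initial run of 1s gives empty rows, which are kept, so that the number of
    rows is the number of 1s. *)
Fixpoint rows (w : word) : seq nat :=
  if w is a :: w' then
    if a == 1 then rcons (rows w') 0 else map succn (rows w')
  else [::].

Lemma size_rows w : size (rows w) = count_mem 1 w.
Proof.
elim: w => //= a w <-; case: (a == 1); first by rewrite size_rcons.
by rewrite size_map.
Qed.

Lemma rows_rcons1 w : binary w -> rows (rcons w 1) = count_mem 2 w :: rows w.
Proof. by elim: w => //= a w IH /andP[/orP[]/eqP-> /IH ->]. Qed.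

Lemma rows_rcons2 w : rows (rcons w 2) = rows w.
Proof. by elim: w => //= a w ->. Qed.

Lemma count_mem_rcons (a b : nat) w : count_mem a (rcons w b) = count_mem a w + (b == a).
Proof. by rewrite -cats1 count_cat /= addn0. Qed.

Lemma rows_le w : binary w -> all (leq^~ (count_mem 2 w)) (rows w).
Proof.
move: w; apply: binary_snoc_ind => // w bw IH.
  by rewrite rows_rcons1 // count_mem_rcons addn0 /= leqnn.
rewrite rows_rcons2 count_mem_rcons /=.
by apply: sub_all IH => x /= /leq_trans; apply; exact: leq_addr.
Qed.

Lemma sorted_geq_cons p (la : seq nat) :
  sorted geq (p :: la) = all (geq p) la && sorted geq la.
Proof. by rewrite /= path_sortedE //; exact/rev_trans/leq_trans. Qed.

Lemma rows_sorted w : binary w -> sorted geq (rows w).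
Proof.
move: w; apply: binary_snoc_ind => // w bw IH; last by rewrite rows_rcons2.
by rewrite rows_rcons1 // sorted_geq_cons IH andbT rows_le.
Qed.

(** The word is recovered up to its final run of 2s, which lies to the right of
    the longest row. *)
Lemma pword_rows w : binary w ->
  w = pword (rows w) ++ nseq (count_mem 2 w - head 0 (rows w)) 2.
Proof.
move: w; apply: binary_snoc_ind => // w bw IH.
  rewrite rows_rcons1 // count_mem_rcons addn0 /= subnn cats0 catA cats1.
  by rewrite -IH.
rewrite rows_rcons2 count_mem_rcons /=.
rewrite -addnBAC; last first.
  by have := rows_le bw; case: (rows w) => //= x s /andP[].
by rewrite nseqD catA -IH cats1.
Qed.

Lemma rows_nseq w n : rows (w ++ nseq n 2) = rows w.
Proof. by elim: w => [|a w /= ->] //; elim: n => //= n ->. Qed.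

Lemma binary_pword la : binary (pword la).
Proof.
elim: la => // p la IH /=; rewrite !binary_cat IH binary_nseq2 //.
Qed.

Lemma head_pword la : P la -> count_mem 2 (pword la) = head 0 la.
Proof.
case/andP; elim: la => // p la IH; rewrite sorted_geq_cons => /andP[pla sla].
case/andP=> _ la0; rewrite /= !count_cat IH //= count_nseq /= mul1n !addn0 subnKC //.
by case: la pla {sla la0 IH} => //= x s /andP[].
Qed.

Lemma rowsK la : P la -> rows (pword la) = la.
Proof.
move=> Pla; have := Pla; case/andP; elim: la Pla => // p la IH Pla.
rewrite sorted_geq_cons => /andP[pla sla] /andP[p0 la0].
have Pla' : P la by apply/andP.
rewrite /= catA cats1 rows_rcons1; last first.
  by rewrite binary_cat binary_pword binary_nseq2.
rewrite count_cat head_pword // count_nseq mul1n subnKC ?rows_nseq ?IH //.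
by case: la pla {sla la0 IH Pla Pla'} => //= x s /andP[].
Qed.

Lemma pword_head la : P la ->
  la = [::] \/ exists2 u, binary u & pword la = 2 :: rcons u 1.
Proof.
case/andP; elim: la => [|p la IH]; first by left.
rewrite sorted_geq_cons => /andP[pla sla] /andP[p0 la0]; right.
case: (IH sla la0) => [->|[u bu /= ->]] /=.
  case: p p0 {pla} => // p _; exists (nseq p 2); last by rewrite subn0 cats1.
  exact: binary_nseq2.
exists (rcons u 1 ++ nseq (p - head 0 la) 2); last by rewrite rcons_cat cats1.
by rewrite binary_cat binary_rcons bu binary_nseq2.
Qed.

Lemma rows_P u : binary u -> P (rows (2 :: u)).
Proof.
move=> bu; apply/andP; split; first exact: rows_sorted.
by rewrite /= all_map; apply/allP.
Qed.

Lemma pword_rows1 u : binary u -> pword (rows (rcons u 1)) = rcons u 1.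
Proof.
move=> bu; have {2}-> := @pword_rows (rcons u 1); last by rewrite binary_rcons.
by rewrite rows_rcons1 // count_mem_rcons addn0 subnn cats0.
Qed.

Lemma sumn_rows_cons2 u : sumn (rows (2 :: u)) = sumn (rows u) + count_mem 1 u.
Proof. by rewrite -size_rows /=; elim: (rows u) => //= x s ->; lia. Qed.

(** * The major index and the inversion number *)

Lemma inv_rcons w a : inv (rcons w a) = inv w + count (ltn a) w.
Proof.
have invE u : inv u = \sum_(0 <= i < size u) \sum_(0 <= j < size u)
    ((i < j) && (nth 0 u j < nth 0 u i)).
  rewrite /inv -sum1_card big_mkcond /= big_mkord.
  under [RHS]eq_bigr do rewrite big_mkord.
  by rewrite pair_bigA /=; apply: eq_bigr => p _; rewrite inE /=; case: ifP.
rewrite !invE size_rcons big_nat_recr //= [X in _ + X]big_nat_cond.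
rewrite [X in _ + X]big1 ?addn0 => [|j /andP[/andP[_ jn] _]]; last first.
  by rewrite ltnNge -ltnS jn.
have -> : count (ltn a) w = \sum_(0 <= i < size w) (a < nth 0 w i).
  by rewrite -sum1_count big_mkcond /= (big_nth 0); apply: eq_bigr => i _; case: ltnP.
rewrite -big_split /= !big_nat; apply: eq_bigr => i /= iw.
rewrite big_nat_recr //= !nth_rcons iw ltnn eqxx; congr (_ + _).
by rewrite !big_nat; apply: eq_bigr => j /= jw; rewrite nth_rcons jw.
Qed.

Lemma inv_rows w : binary w -> inv w = sumn (rows w).
Proof.
move: w; apply: binary_snoc_ind => [|w bw IH|w bw IH].
- by rewrite /inv; apply: eq_card0 => -[[]].
- rewrite inv_rcons rows_rcons1 //= IH addnC; congr (_ + _).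
  by apply: eq_in_count => x /(allP bw) /orP[]/eqP->.
- rewrite inv_rcons rows_rcons2 IH (_ : count _ _ = 0) ?addn0 //.
  by apply/eqP; rewrite -leqn0 leqNgt -has_count; apply/hasPn => x /(allP bw) /orP[]/eqP->.
Qed.

Lemma Des_cons2 a b v :
  Des [:: a, b & v] = (if b < a then [:: 1] else [::]) ++ map succn (Des (b :: v)).
Proof.
rewrite /Des /index_iota /= !subn1 /=.
rewrite -[2]/(1 + 1)%N iotaDl filter_map.
have E : [seq i <- iota 1 (size v) | preim (addn 1) (fun i =>
             letter [:: a, b & v] i.+1 < letter [:: a, b & v] i) i] =
         [seq i <- iota 1 (size v) | letter (b :: v) i.+1 < letter (b :: v) i].
  by apply: eq_in_filter => -[|i] //; rewrite mem_iota.
by rewrite E; case: ifP.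
Qed.

Lemma Des_rcons2 v a b :
  Des (rcons (rcons v a) b) = Des (rcons v a) ++ (if b < a then [:: (size v).+1] else [::]).
Proof.
case: v => [|c v] /=; first by rewrite Des_cons2 cats0.
elim: v c => [|d v IH] c /=.
  by rewrite !Des_cons2; case: (b < a); case: (a < c).
by rewrite !Des_cons2 IH map_cat -catA; case: (b < a).
Qed.

Lemma mem_Des v i : i \in Des v -> 0 < i < size v.
Proof. by rewrite mem_filter mem_index_iota => /andP[]. Qed.

Lemma maj_rcons2 v a b :
  maj (rcons (rcons v a) b) = maj (rcons v a) + (if b < a then (size v).+1 else 0).
Proof.
rewrite /maj Des_rcons2 big_cat /=; case: (b < a); by rewrite ?big_seq1 ?big_nil.
Qed.

Lemma maj_rcons_2 v : binary v -> maj (rcons v 2) = maj v.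
Proof.
case/lastP: v => [_|v a]; first by rewrite /maj big_nil.
by rewrite binary_rcons maj_rcons2 => /andP[/orP[]/eqP->]; rewrite addn0.
Qed.

(** Appending 1 after a 1 changes neither side, because the rotation only adds
    an empty row. For [x 2 1] the descent contributes [size x + 1], which is
    the number of cells of the hook added by [2 u 1] for [u = foata x]. *)
Lemma maj_foata v : binary v -> maj v = sumn (rows (foata v)).
Proof.
have [n] := ubnP (size v); elim: n v => // n IH v.
case/lastP: v => [_ _|v a]; first by rewrite /maj big_nil.
rewrite size_rcons ltnS binary_rcons => sv /andP[/orP[]/eqP-> bv]; last first.
  by rewrite maj_rcons_2 // foata_rcons2 // rows_rcons2 IH.
case/lastP: v => [|x c] in sv bv *; first by rewrite /maj big_nil.
rewrite size_rcons in sv; rewrite maj_rcons2.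
move: (bv); rewrite binary_rcons => /andP[/orP[]/eqP Ea bx]; rewrite Ea in bv *.
  rewrite addn0 IH ?size_rcons // (foata_rcons1 bv) foata_rcons1 // rotr1_rcons.
  by rewrite /= sumn_rcons addn0.
rewrite foata_rcons21 // maj_rcons_2 // IH //; last exact: ltnW.
rewrite -rcons_cons rows_rcons1 /= ?binary_foata //.
have bfx : binary (foata x) by rewrite binary_foata.
have -> : sumn (map succn (rows (foata x))) = sumn (rows (foata x)) + count_mem 1 (foata x).
  exact: sumn_rows_cons2.
have := binary_size bfx; rewrite (perm_size (perm_foata x)) => <-.
by move: (count _ _) (count _ _) (sumn _) => p q t; lia.
Qed.

(** * Successive ranks and conjugation *)

(** The cell in row [i] and column [j] (counted from 0) is read by columns on
    the left and by rows on the right; this exchange is what makes conjugation an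
    involution. *)
Lemma ltn_count la i j : sorted geq la ->
  (i < count (leq j.+1) la) = (j < nth 0 la i).
Proof.
elim: la i => [|p la IH] i; first by rewrite nth_nil.
rewrite sorted_geq_cons => /andP[pla sla].
case: i => [|i] /=; rewrite -?IH //; case: (ltnP j p) => // jp.
  rewrite ltnNge leqn0 /= -leqn0 leqNgt -has_count; apply/negbTE; rewrite negbK.
  by apply/hasPn => x /(allP pla) /= xp; rewrite -ltnNge ltnS (leq_trans xp).
have -> : count (leq j.+1) la = 0; last by [].
apply/eqP; rewrite -leqn0 leqNgt -has_count.
by apply/hasPn => x /(allP pla) /= xp; rewrite -ltnNge ltnS (leq_trans xp).
Qed.

Lemma eq_nat_ltn a b : (forall d, (d < a) = (d < b)) -> a = b.
Proof.
move=> E; apply/eqP; rewrite eqn_leq.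
by rewrite leqNgt E ltnn leqNgt -E ltnn.
Qed.

Lemma nth_sorted (la : seq nat) i j : sorted geq la -> i <= j -> nth 0 la j <= nth 0 la i.
Proof.
move=> sla ij; case: (ltnP j (size la)) => js; last by rewrite nth_default.
have tr : transitive geq by exact/rev_trans/leq_trans.
exact: (sorted_leq_nth tr leqnn 0 sla i j (leq_ltn_trans ij js) js ij).
Qed.

(** The Durfee square has more than [d] rows when the diagonal cell of index [d]
    belongs to the diagram. *)
Lemma durfee_gt la d : sorted geq la -> (d < durfee la) = (d < nth 0 la d).
Proof.
move=> sla.
have all_take k : k < (size la).+1 ->
    all (leq k) (take k la) = ((k == 0) || (k <= nth 0 la k.-1)).
  case: k => [|k] ks; first by rewrite take0.
  apply/allP/idP => /= [H|kl x].
    apply: H; rewrite -(nth_take 0 (ltnSn k)); apply: mem_nth.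
    by rewrite size_take_min leq_min ltnSn.
  move/(nthP 0) => [i]; rewrite size_take_min => /leq_trans/(_ (geq_minl _ _)) ik <-.
  by rewrite nth_take // (leq_trans kl) // nth_sorted.
apply/idP/idP => [dd|dl].
  have : durfee la \in [pred k : nat | (k <= size la) && all (leq k) (take k la)].
    rewrite /durfee; elim/big_ind: _; rewrite ?inE ?take0 //.
      by move=> x y Hx Hy; rewrite /maxn; case: ifP.
    by move=> i ?; rewrite inE -ltnS ltn_ord.
  rewrite inE => /andP[ks]; rewrite all_take // -leqn0 leqNgt (leq_ltn_trans _ dd) //=.
  move=> /(leq_trans dd)/leq_trans; apply; apply: nth_sorted => //.
  by rewrite -ltnS prednK // (leq_ltn_trans _ dd).
have ds : d < size la by rewrite ltnNge; apply/negP => /(nth_default 0) E; rewrite E in dl.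
pose P0 := fun k : 'I_(size la).+1 => all (leq k) (take k la).
have PD : P0 (Ordinal (ds : d.+1 < (size la).+1)) by rewrite /P0 all_take.
exact: (@leq_bigmax_cond 'I_(size la).+1 P0 (@nat_of_ord _) _ PD).
Qed.

Lemma part_conj la i : sorted geq la -> 0 < i -> part (conjugate la) i = count (leq i) la.
Proof.
case: i => // i sla _; rewrite /part /conjugate /=.
case: (ltnP i (nth 0 la 0)) => i0.
  rewrite (nth_map 0) /index_iota /part /= ?subn1 ?size_iota //.
  by rewrite nth_iota.
rewrite nth_default; last by rewrite size_map size_iota subn1.
by apply/esym/eqP; rewrite -leqn0 leqNgt ltn_count // -leqNgt.
Qed.

Lemma r_count la i : sorted geq la -> 0 < i ->
  r_ la i = ((part la i)%:Z - (count (leq i) la)%:Z)%R.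
Proof. by move=> sla i0; rewrite /r_ part_conj. Qed.

Definition ranks la : seq int := [seq r_ la i | i <- iota 1 (durfee la)].

Lemma size_ranks la : size (ranks la) = durfee la.
Proof. by rewrite size_map size_iota. Qed.

Lemma sorted_hook p mu : sorted geq (p :: mu) -> sorted geq (p.+1 :: map succn mu).
Proof.
by rewrite !sorted_geq_cons all_map sorted_map.
Qed.

(** Adding a hook with arm [p] and leg [size mu] around [mu] shifts the diagonal
    by one, so the old ranks are kept and the difference of arm and leg is put
    in front. *)
Lemma ranks_hook p mu : sorted geq (p :: mu) ->
  ranks (p.+1 :: map succn mu) = (p%:Z - (size mu)%:Z)%R :: ranks mu.
Proof.
move=> spm; have sm : sorted geq mu by move: spm; rewrite sorted_geq_cons => /andP[].
have sh := sorted_hook spm.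
have dE : durfee (p.+1 :: map succn mu) = (durfee mu).+1.
  apply: eq_nat_ltn => -[|d]; rewrite durfee_gt //= ltnS durfee_gt //.
  case: (ltnP d (size mu)) => dm; first by rewrite (nth_map 0).
  by rewrite !nth_default ?size_map.
rewrite /ranks dE /= r_count //; congr (_ :: _).
  rewrite /part /= count_map (eq_count (a2 := predT)) // count_predT; lia.
rewrite -[2]/(1 + 1)%N iotaDl -map_comp; apply/eq_in_map => -[|i]; rewrite mem_iota //.
move=> /andP[_]; rewrite add1n ltnS durfee_gt // => imu.
have im : i < size mu by rewrite ltnNge; apply/negP => /(nth_default 0) E; rewrite E in imu.
have ip : i < p.
  by have := nth_sorted (j := i.+1) spm (leq0n _); apply: leq_trans.
rewrite /= add1n !r_count // /part /= count_map (nth_map 0) // ltnS ip.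
rewrite (eq_count (a2 := leq i.+1)) //; lia.
Qed.

Lemma ranks_rcons0 mu : sorted geq mu -> ranks (rcons mu 0) = ranks mu.
Proof.
move=> sm; have n0 i : nth 0 (rcons mu 0) i = nth 0 mu i.
  rewrite nth_rcons; case: ltnP => // im; rewrite nth_default //.
  by case: eqP.
have sr : sorted geq (rcons mu 0).
  rewrite -cats1; elim: mu sm {n0} => // p mu IH.
  by rewrite cat_cons !sorted_geq_cons all_cat /= andbT => /andP[-> /IH].
have dE : durfee (rcons mu 0) = durfee mu.
  by apply: eq_nat_ltn => d; rewrite !durfee_gt // n0.
rewrite /ranks dE; apply/eq_in_map => -[|i]; rewrite mem_iota // => _.
by rewrite !r_count // /part n0 -cats1 count_cat /= !addn0.
Qed.

Lemma eq_partition la mu : P la -> P mu ->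
  (forall i, nth 0 la i = nth 0 mu i) -> la = mu.
Proof.
move=> /andP[_ pl] /andP[_ pm] E.
have sz la' : all (leq 1) la' -> forall i, (i < size la') = (0 < nth 0 la' i).
  move=> /allP p i; case: ltnP => il; first by rewrite p // mem_nth.
  by rewrite nth_default.
apply: (@eq_from_nth _ 0) => [|i _]; last exact: E.
by apply: eq_nat_ltn => d; rewrite !sz // E.
Qed.

Lemma P_conj la : P la -> P (conjugate la).
Proof.
move=> /andP[sla _]; apply/andP; split.
  rewrite sorted_map; apply: (@sub_sorted _ ltn); last exact: iota_ltn_sorted.
  by move=> i j ij /=; apply: sub_count => x; apply: leq_trans (ltnW ij).
apply/allP => x /mapP[[|j]]; rewrite mem_index_iota // => /andP[_ jl] ->.
by rewrite ltn_count.
Qed.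

Lemma nth_conj la i : P la -> nth 0 (conjugate la) i = count (leq i.+1) la.
Proof. by move=> /andP[sla _]; rewrite -part_conj. Qed.

Lemma conjK la : P la -> conjugate (conjugate la) = la.
Proof.
move=> Pl; have Pc := P_conj Pl; apply: eq_partition => // [|i]; first exact: P_conj.
apply: eq_nat_ltn => d; rewrite nth_conj // ltn_count //; last by case/andP: Pc.
by rewrite nth_conj // ltn_count //; case/andP: Pl.
Qed.

Lemma durfee_conj la : P la -> durfee (conjugate la) = durfee la.
Proof.
move=> Pl; have Pc := P_conj Pl; have /andP[sl _] := Pl; have /andP[sc _] := Pc.
by apply: eq_nat_ltn => d; rewrite !durfee_gt // nth_conj // ltn_count.
Qed.

Lemma r_conj la i : P la -> r_ (conjugate la) i = (- r_ la i)%R.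
Proof. by move=> Pl; rewrite /r_ conjK // opprB. Qed.

(** Double counting of the cells: a part [p] meets the columns [1, ..., p]. *)
Lemma sumn_conj la : P la -> sumn (conjugate la) = sumn la.
Proof.
move=> /andP[sl _]; rewrite /conjugate.
have -> : part la 1 = nth 0 la 0 by [].
have : all (leq^~ (nth 0 la 0)) la.
  by apply/(all_nthP 0) => i il; exact: nth_sorted.
move: (nth 0 la 0) => m {sl}; rewrite /index_iota subn1 /=.
elim: la => [|p la IH] /=; first by elim: (iota 1 m).
case/andP=> pm /IH <-.
have E : p = sumn [seq (leq j p : nat) | j <- iota 1 m].
  suff -> k : sumn [seq (leq j p : nat) | j <- iota 1 k] = minn p k by apply/esym/minn_idPl.
  elim: k => [|k IHk]; first by rewrite minn0.
  by rewrite -[k.+1]addn1 iotaD map_cat sumn_cat IHk /=; lia.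
by rewrite [X in _ = X + _]E; elim: (iota 1 m) => //= j s ->; lia.
Qed.

(** The multiplicity of 1 in the conjugate is the difference of the two largest
    parts. *)
Lemma conj_neq1 la : P la -> (1 \notin conjugate la) = (nth 0 la 0 == nth 0 la 1).
Proof.
move=> Pl; have /andP[sl _] := Pl.
have E i : (nth 0 (conjugate la) i == 1) = (nth 0 la 1 <= i < nth 0 la 0).
  rewrite nth_conj // -ltn_count // [X in X && _]leqNgt -ltn_count //; lia.
apply/idP/eqP => [H|H].
  apply/eqP; rewrite eqn_leq (nth_sorted sl (leq0n 1)) andbT leqNgt; apply: contra H => H.
  (* the first column that meets only the first row *)
  have /eqP <- : nth 0 (conjugate la) (nth 0 la 1) == 1 by rewrite E leqnn.
  apply: mem_nth; rewrite size_map size_iota subn1.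
  exact: H.
apply/negP => /(nthP 0)[i _ /eqP]; rewrite E H; lia.
Qed.

(** * Peaks of words and ranks of partitions *)

Definition level (w : word) : int := ((count_mem 2 w)%:Z - (count_mem 1 w)%:Z)%R.

(** The word is seen as a path with a step up for 2 and a step down for 1;
    its descents are the peaks of the path. *)
Definition peaks (w : word) : seq int := [seq level (take i w) | i <- Des w].

Lemma level_cons a w : level (a :: w) = (level [:: a] + level w)%R.
Proof. by rewrite /level /= !addn0 !PoszD; ring. Qed.

Lemma level_rcons w a : level (rcons w a) = (level w + level [:: a])%R.
Proof. by rewrite /level !count_mem_rcons /= !addn0 !PoszD; ring. Qed.

Lemma size_peaks w : size (peaks w) = des w.
Proof. by rewrite size_map. Qed.

Lemma peaks_cons2 a b w :
  peaks [:: a, b & w] = (if b < a then [:: level [:: a]] else [::]) ++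
                        [seq (level [:: a] + x)%R | x <- peaks (b :: w)].
Proof.
rewrite /peaks Des_cons2 map_cat; congr (_ ++ _); first by case: ifP.
by rewrite -!map_comp; apply: eq_map => i; rewrite /= level_cons.
Qed.

Lemma peaks_rcons2 w a b :
  peaks (rcons (rcons w a) b) =
  peaks (rcons w a) ++ (if b < a then [:: level (rcons w a)] else [::]).
Proof.
rewrite /peaks Des_rcons2 map_cat; congr (_ ++ _).
  apply/eq_in_map => i /mem_Des /andP[_ iw].
  by rewrite -[rcons _ b]cats1 take_cat iw.
case: ifP => //= _.
by rewrite -[rcons _ b]cats1 take_cat size_rcons ltnn subnn cats0.
Qed.

Lemma peaks_rcons_2 w : binary w -> peaks (rcons w 2) = peaks w.
Proof.
case/lastP: w => [|w a] //.
by rewrite binary_rcons peaks_rcons2 => /andP[/orP[]/eqP-> _]; rewrite cats0.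
Qed.

Lemma peaks_rcons11 w : peaks (rcons (rcons w 1) 1) = peaks (rcons w 1).
Proof. by rewrite peaks_rcons2 cats0. Qed.

Lemma peaks_rcons21 w : binary w ->
  peaks (rcons (rcons w 2) 1) = rcons (peaks w) (level w + 1)%R.
Proof.
by move=> bw; rewrite peaks_rcons2 peaks_rcons_2 //= cats1 level_rcons.
Qed.

Lemma level_foata v : level (foata v) = level v.
Proof. by rewrite /level !(permP (perm_foata v)). Qed.

Lemma ranks_nil : ranks [::] = [::].
Proof.
by apply/eqP; rewrite -size_eq0 size_ranks -leqn0 leqNgt durfee_gt.
Qed.

(** The induction follows the recursion of [foata]. Appending 2, or 1 after a 1,
    adds no peak, and on the other side it changes nothing or adds an empty row.
    For [x 2 1], the hook added by [2 u 1] with [u = foata x] has rank [level u = level x],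
    one less than the height of the new peak. *)
Lemma ranks_foata v : binary v ->
  ranks (rows (foata v)) = rev [seq (x - 1)%R | x <- peaks v].
Proof.
have [n] := ubnP (size v); elim: n v => // n IH v.
case/lastP: v => [_ _|v a].
  exact: ranks_nil.
rewrite size_rcons ltnS binary_rcons => sv /andP[/orP[]/eqP-> bv]; last first.
  by rewrite foata_rcons2 // rows_rcons2 IH // peaks_rcons_2.
case/lastP: v => [|x c] in sv bv *.
  by rewrite (foata_rcons1 bv) /= (@ranks_rcons0 [::]) // ranks_nil.
rewrite size_rcons in sv.
move: (bv); rewrite binary_rcons => /andP[/orP[]/eqP Ec bx]; rewrite Ec in bv *.
  rewrite peaks_rcons11 -IH ?size_rcons // (foata_rcons1 bv) foata_rcons1 // rotr1_rcons.
  rewrite /= ranks_rcons0 // rows_sorted // binary_rcons /=.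
  move: bx; rewrite -binary_foata; case/lastP: (foata x) => // s y.
  by rewrite rotr1_rcons binary_rcons.
rewrite foata_rcons21 // peaks_rcons21 //.
have bfx : binary (foata x) by rewrite binary_foata.
rewrite /= rows_rcons1 //= ranks_hook; last by rewrite sorted_geq_cons rows_le ?rows_sorted.
rewrite map_rcons rev_rcons -IH //; last exact: ltnW.
by congr (_ :: _); rewrite size_rows -[LHS]/(level (foata x)) level_foata addrK.
Qed.

Lemma durfee_foata v : binary v -> durfee (rows (foata v)) = des v.
Proof.
by move=> bv; rewrite -size_ranks ranks_foata // size_rev size_map size_peaks.
Qed.

(** The numbers e_i, as a function of the exponents of the blocks. *)
Definition heights (s : seq (nat * nat)) : seq int :=
  [seq (\sum_(0 <= j < i.+1) ((nth (0, 0) s j).2%:Z - (nth (0, 0) s j).1%:Z))%R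
     | i <- iota 0 (size s)].

Lemma heights_cons b s :
  heights (b :: s) = (b.2%:Z - b.1%:Z)%R ::
    [seq (b.2%:Z - b.1%:Z + x)%R | x <- heights s].
Proof.
rewrite /heights /= big_nat1 /=; congr (_ :: _).
rewrite -[1]/(1 + 0)%N iotaDl -!map_comp; apply: eq_map => i /=.
by rewrite big_nat_recl.
Qed.

Lemma blocks_head v : binary v ->
    ((head (0, 0) (blocks v)).1 == 0) = (head 2 v == 2).
Proof.
  case: v => //= b w /andP[b12 _]; rewrite -/(blocks w).
  have [m [n [s ->]]] := blocks_cons w.
  by case/orP: b12 => /eqP -> //=; case: (m == 0).
Qed.

Lemma heights_shift c b b' s : (b'.2%:Z - b'.1%:Z = c + (b.2%:Z - b.1%:Z) :> int)%R ->
  heights (b' :: s) = [seq (c + x)%R | x <- heights (b :: s)].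
Proof.
move=> E; rewrite !heights_cons E /= -map_comp; congr (_ :: _).
by apply: eq_map => x /=; rewrite !addrA.
Qed.

(** Each block but the last ends at a peak; the last one ends at the end of the
    word. *)
Lemma heights_blocks v : binary v -> heights (blocks v) = rcons (peaks v) (level v).
Proof.
elim: v => [_|a [|b v] IH]; first by rewrite /heights /= big_nat1.
  by case/andP=> /orP[]/eqP-> _; rewrite /heights /= big_nat1.
rewrite binary_cons => /andP[a12 bv]; have := blocks_head bv; move: (IH bv).
have -> : blocks [:: a, b & v] = let: (m, n) := head (0, 0) (blocks (b :: v)) in
           if a == 1 then (m.+1, n) :: behead (blocks (b :: v))
           else if m == 0 then (0, n.+1) :: behead (blocks (b :: v))
           else (0, 1) :: (blocks (b :: v)) by [].
have [m [n [s ->]]] := blocks_cons (b :: v); rewrite [head _ _]/= [behead _]/= => E /= m0.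
rewrite level_cons peaks_cons2 rcons_cat 
  -[X in _ ++ rcons _ X]/((fun x => level [:: a] + x)%R (level (b :: v))).
rewrite -map_rcons -E; have b12 : (b == 1) || (b == 2) by case/andP: bv.
case/orP: a12 => /eqP-> /=.
  have -> : b < 1 = false by case/orP: b12 => /eqP->.
  by apply: heights_shift; rewrite /= /level /=; lia.
rewrite m0; case/orP: b12 m0 => /eqP-> /= m0; first by rewrite heights_cons.
by apply: heights_shift; rewrite /= (eqP m0) /level /=; lia.
Qed.

Lemma heights_e v : binary v -> heights (blocks v) = [seq e_ v i | i <- iota 0 (des v).+1].
Proof. by move=> bv; rewrite /heights size_blocks. Qed.

(** [e] and [r] are iterated maxima over lists in opposite orders, with
    different starting values; membership and upper bounds make them comparable. *)
Definition is_max (s : seq int) (m : int) := (m \in s) && all (fun x => (x <= m)%R) s.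

Lemma is_max_uniq s m m' : is_max s m -> is_max s m' -> m = m'.
Proof.
move=> /andP[ms /allP H] /andP[ms' /allP H'].
by apply/eqP; rewrite eq_le H' // H.
Qed.

Lemma bigmax_is_max (I : eqType) (s : seq I) (F : I -> int) i0 :
  i0 \in s -> is_max (map F s) (\big[Order.max/F i0]_(i <- s) F i).
Proof.
move=> i0s; apply/andP.
have [H1 _ H3] : [/\ \big[Order.max/F i0]_(i <- s) F i \in F i0 :: map F s,
    (F i0 <= \big[Order.max/F i0]_(i <- s) F i)%R &
    all (fun x => (x <= \big[Order.max/F i0]_(i <- s) F i)%R) (map F s)].
  elim: s {i0s} => [|i s [IH1 IH2 IH3]]; first by rewrite big_nil /= mem_head.
  rewrite big_cons /= le_max IH2 orbT le_max lexx /=; split=> //.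
    case: leP => _; last by rewrite !inE eqxx orbT.
    by move: IH1; rewrite !inE => /orP[]->; rewrite ?orbT.
  by apply: sub_all IH3 => x; rewrite le_max orbC => ->.
by split=> //; move: H1; rewrite inE => /predU1P[->|//]; exact: map_f.
Qed.

Lemma e_is_max v : binary v -> is_max (rcons (peaks v) (level v)) (e v).
Proof.
move=> bv; rewrite -heights_blocks // heights_e //.
have := @bigmax_is_max _ (iota 0 (des v).+1) (e_ v) 0.
rewrite /e /index_iota subn0; apply; exact: mem_head.
Qed.

Lemma r_is_max la : la != [::] -> 0 < durfee la -> is_max (ranks la) (r la).
Proof.
case: la => // p la _ d0.
have := @bigmax_is_max _ (iota 1 (durfee (p :: la))) (r_ (p :: la)) 1.
rewrite /r /index_iota subn1; apply; by rewrite mem_iota add1n ltnS.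
Qed.

Lemma W21_decomp v : W [:: 2; 1] v ->
  v = [::] \/ exists2 x, binary x & v = rcons (rcons x 2) 1.
Proof.
case=> [[x bx ->]|->]; [right|by left].
by exists x => //; rewrite -!cats1 -catA.
Qed.

(** A word [x 2 1] ends one step below its last peak, so the height of its end
    does not contribute to [e]. *)
Lemma e_foata v : W [:: 2; 1] v -> e v = (r (rows (foata v)) + 1)%R.
Proof.
case/W21_decomp => [->|[x bx ->]].
  by have := @e_is_max [::] isT; rewrite /is_max inE => /andP[/eqP->].
have bv : binary (rcons (rcons x 2) 1) by rewrite !binary_rcons.
apply: is_max_uniq (e_is_max bv) _.
have : is_max (ranks (rows (foata (rcons (rcons x 2) 1))))
              (r (rows (foata (rcons (rcons x 2) 1)))).
  apply: r_is_max; first by rewrite foata_rcons21 // /= rows_rcons1 ?binary_foata.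
  by rewrite durfee_foata // -size_peaks peaks_rcons21 // size_rcons.
move: (r _) => m; rewrite ranks_foata // /is_max mem_rev all_rev.
rewrite -[m in m \in _](addrK 1%R) (mem_map (addIr _)) all_map.
case/andP=> ms /allP mx; rewrite mem_rcons inE ms orbT /=; apply/allP => y.
have mx' z : z \in peaks (rcons (rcons x 2) 1) -> (z <= m + 1)%R.
  by move/mx => /=; rewrite lerBlDr.
rewrite mem_rcons inE => /predU1P[->|]; last exact: mx'.
rewrite level_rcons level_rcons /level /= -/(level x).
apply: le_trans (mx' (level x + 1)%R _); last by rewrite peaks_rcons21 // mem_rcons mem_head.
by rewrite /level; lia.
Qed.

Lemma level_le0 w : (level w <= 0)%R = (count_mem 2 w <= count_mem 1 w).
Proof. by rewrite /level subr_le0 lez_nat. Qed.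

Lemma ballot_rcons w a : ballot (rcons w a) <-> ballot w /\ (level (rcons w a) <= 0)%R.
Proof.
split=> [H|[H lw] k].
  split=> [k|]; last by have := H (size w).+1; rewrite take_oversize ?size_rcons // level_le0.
  have := H (minn k (size w)); rewrite -cats1 takel_cat ?geq_minr //.
  by rewrite /minn; case: ltnP => // wk; rewrite take_size take_oversize.
case: (leqP k (size w)) => kw; first by rewrite -cats1 takel_cat.
by rewrite take_oversize ?size_rcons // -level_le0.
Qed.

(** A path that rises above 0 does so at a peak, once the letter 1 appended to
    [v] has turned a final ascent into a peak. *)
Lemma ballot_peaks v : binary v -> ballot v <-> all (fun x => (x <= 0)%R) (peaks (rcons v 1)).
Proof.
move: v; apply: binary_snoc_ind => [|v bv IH|v bv IH]; first by split.
  rewrite peaks_rcons11; split=> [/ballot_rcons[/IH]//|/IH H].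
  apply/ballot_rcons; split => //; move: (H (size v)); rewrite take_size -level_le0 level_rcons.
  by move: (level v) => l; rewrite /level /=; lia.
rewrite peaks_rcons21 // all_rcons; split => [/ballot_rcons[bw lw]|/andP[lv pv]].
  move: lw; rewrite level_rcons => -> /=; move/IH: bw.
  case/lastP: v {bv IH} => // v a; rewrite peaks_rcons2 all_cat => /andP[] //.
apply/ballot_rcons; rewrite level_rcons; split => //; apply/IH.
case/lastP: v pv lv {bv IH} => // v a pv lv; rewrite peaks_rcons2 all_cat pv.
by case: ifP => //= _; rewrite andbT; move: lv; move: (level _) => l; lia.
Qed.

(** * The three inverse images *)

Lemma words_ofP (T : set (seq nat)) w : T `<=` P ->
  words_of T w <-> words_of P w /\ T (rows w).
Proof.
move=> TP; split=> [[la Tla <-]|[[la Pla <-]]].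
  by split; [exists la => //; exact: TP|rewrite rowsK //; exact: TP].
by rewrite rowsK // => Tla; exists la.
Qed.

Lemma words_of_P w :
  words_of P w <-> w = [::] \/ exists2 u, binary u & w = 2 :: rcons u 1.
Proof.
split=> [[la Pla <-]|[->|[u bu ->]]].
- by case: (pword_head Pla) => [->|[u bu ->]]; [left|right; exists u].
- by exists [::].
- exists (rows (rcons (2 :: u) 1)); last exact: (@pword_rows1 (2 :: u)).
  by rewrite rcons_cons; apply: rows_P; rewrite binary_rcons.
Qed.

(** The last letter of [foata v] is that of [v], and for [v = y 1] its first
    letter is the last letter of [y]. *)
Lemma foata_W21 v : (Pstar v /\ words_of P (foata v)) <-> W [:: 2; 1] v.
Proof.
split=> [[_ /words_of_P H]|/W21_decomp[->|[x bx ->]]]; last first.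
- split; first by apply: binary_positive; rewrite !binary_rcons.
  apply/words_of_P; right; exists (foata x); rewrite ?binary_foata //.
  by rewrite foata_rcons21.
- by split=> //; apply/words_of_P; left.
have bv : binary v.
  by rewrite -binary_foata; case: H => [->//|[u bu ->]]; rewrite binary_cons binary_rcons.
case: H => [E|[u bu]].
  by right; apply: foata_inj.
case/lastP: v bv => [//|v a]; rewrite binary_rcons => /andP[a12 bv] E.
have Ea : a = 1.
  have := congr1 (last 0) E; rewrite last_foata last_rcons => ->.
  by rewrite -rcons_cons last_rcons.
rewrite {}Ea {a a12} foata_rcons1 // -rcons_cons in E *.
case/rcons_inj: E; case/lastP: v bv => // x a.
have : last 0 (foata (rcons x a)) = a by rewrite last_foata last_rcons.
case/lastP: (foata _) => [/= <-|s c]; 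
  rewrite ?last_rcons ?rotr1_rcons binary_rcons; first by [].
by move=> <- /andP[_ bx] [-> _]; left; exists x => //; rewrite -!cats1 -catA.
Qed.

Lemma preim_foata (S : set word) (T : set (seq nat)) : T `<=` P -> S `<=` W [:: 2; 1] ->
  (forall v, W [:: 2; 1] v -> S v <-> T (rows (foata v))) ->
  Pstar `&` foata @^-1` words_of T = S.
Proof.
move=> TP SW H; apply/seteqP; split=> v.
  by case=> pv /= /(words_ofP _ TP)[wv Tv]; apply/H => //; apply/foata_W21.
move=> Sv; have Wv := SW _ Sv; have [pv wv] := (foata_W21 v).2 Wv.
by split=> //=; apply/(words_ofP _ TP); split=> //; apply/H.
Qed.

Lemma conj_set_P (L : set (seq nat)) la : L `<=` P ->
  conj_set L la <-> P la /\ L (conjugate la).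
Proof.
move=> LP; split=> [[mu Lmu <-]|[Pla Lla]].
  by have Pm := LP _ Lmu; rewrite conjK //; split=> //; exact: P_conj.
by exists (conjugate la) => //; exact: conjK.
Qed.

Lemma conj_R_ge1 la : conj_set R_ge1 la <-> P la /\ all (fun x => (x <= -1)%R) (ranks la).
Proof.
rewrite conj_set_P; last by move=> x [].
split=> [[Pl [_ H]]|[Pl H]]; split=> //.
  apply/allP => x /mapP[i]; rewrite mem_iota add1n ltnS => id ->.
  by have := H i; rewrite durfee_conj // r_conj // => /(_ id); rewrite lerNr.
split; first exact: P_conj.
move=> i; rewrite durfee_conj // r_conj // lerNr => id.
by apply: (allP H); apply: map_f; rewrite mem_iota add1n ltnS.
Qed.

Lemma conj_P_neq1 la : conj_set P_neq1 la <-> P la /\ nth 0 la 0 = nth 0 la 1.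
Proof.
rewrite conj_set_P; last by move=> x [].
split=> [[Pl [_]]|[Pl H]]; first by rewrite conj_neq1 // => /eqP.
split=> //; split; first exact: P_conj.
by rewrite conj_neq1 //; apply/eqP.
Qed.

Lemma ballot_W21 v : W [:: 2; 1] v -> ballot v <-> all (fun x => (x <= 0)%R) (peaks v).
Proof.
case/W21_decomp => [->|[x bx ->]]; first by split.
have bv : binary (rcons (rcons x 2) 1) by rewrite !binary_rcons.
by rewrite ballot_peaks // peaks_rcons11.
Qed.

(** A peak of height at most 0 is a rank at most -1, that is, a rank at
    least 1 of the conjugate. *)
Lemma foata_B21 v : W [:: 2; 1] v ->
  B [:: 2; 1] v <-> conj_set R_ge1 (rows (foata v)).
Proof.
move=> Wv.
have Pv : P (rows (foata v)).
  by case: ((foata_W21 v).2 Wv) => _ [la Pla <-]; rewrite rowsK.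
have bv : binary v.
  by case/W21_decomp: Wv => [->|[x bx ->]] //; rewrite !binary_rcons.
rewrite conj_R_ge1 ranks_foata // all_rev all_map.
have E : all (fun x => (x <= 0)%R) (peaks v) =
         all (preim (fun x => (x - 1)%R) (fun x => (x <= -1)%R)) (peaks v).
  by apply: eq_all => x /=; rewrite -[(-1)%R]add0r lerD2r.
rewrite -E; split=> [[_ /= /(ballot_W21 Wv)]|[_ /(ballot_W21 Wv)]] //.
Qed.

(** The default letter 2 excludes the empty word [x]. *)
Lemma W121_rcons x :
  W [:: 1; 2; 1] (rcons (rcons x 2) 1) <-> binary x /\ last 2 x = 1.
Proof.
split=> [[[y by_ /(congr1 rev)]|/(congr1 size)]|[]].
- rewrite rev_cat !rev_rcons => -[E]; rewrite -[x]revK E rev_cons last_rcons.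
  by rewrite revK binary_rcons.
- by rewrite size_rcons.
- case/lastP: x => // y a; rewrite binary_rcons last_rcons => /andP[_ yb] ->.
  by left; exists y => //; rewrite -!cats1 -!catA.
Qed.

(** The two longest rows of [2 u 1] have equal length when [u] ends with 1, and
    [u = foata x] ends with the same letter as [x]. *)
Lemma foata_W121 v : W [:: 2; 1] v ->
  W [:: 1; 2; 1] v <-> conj_set P_neq1 (rows (foata v)).
Proof.
move=> Wv.
have Pv : P (rows (foata v)).
  by case: ((foata_W21 v).2 Wv) => _ [la Pla <-]; rewrite rowsK.
have PX X : P (rows (foata v)) /\ X <-> X by split=> [[]|].
rewrite conj_P_neq1 {}PX {Pv}; case/W21_decomp: Wv => [->|[x bx ->]].
  by split=> // _; right.
rewrite foata_rcons21 // -rcons_cons /= rows_rcons1 ?binary_foata //.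
have lx := last_foata 2 x; have := bx; rewrite -binary_foata.
have -> : W [:: 1; 2; 1] (rcons (rcons x 2) 1) <-> last 2 x = 1.
  by rewrite W121_rcons; split=> [[]|].
rewrite -lx; case/lastP: (foata x) => [|u a] /=; first by split.
rewrite binary_rcons last_rcons count_mem_rcons => /andP[/orP[]/eqP-> bu].
  by rewrite rows_rcons1 //=; split=> // _; rewrite addn0.
rewrite rows_rcons2; have := rows_le bu; case: (rows u) => [|p s] /=; first by split.
by case/andP=> pu _; split=> // -[E]; move: pu; rewrite -E addn1 ltnn.
Qed.

Lemma W121_sub_W21 : W [:: 1; 2; 1] `<=` W [:: 2; 1].
Proof.
move=> v [[x bx ->]|->]; [left|by right].
by exists (rcons x 1); rewrite ?binary_rcons // -cats1 -catA.
Qed.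

Lemma B21_sub_W21 : B [:: 2; 1] `<=` W [:: 2; 1].
Proof. by move=> v []. Qed.

Lemma conj_R_ge1_sub : conj_set R_ge1 `<=` P.
Proof. by move=> la /conj_R_ge1[]. Qed.

Lemma conj_P_neq1_sub : conj_set P_neq1 `<=` P.
Proof. by move=> la /conj_P_neq1[]. Qed.

Lemma foata_preim_P : Pstar `&` foata @^-1` words_of P = W [:: 2; 1].
Proof.
apply: preim_foata => // v Wv; split=> // _.
by case: ((foata_W21 v).2 Wv) => _ [la Pla <-]; rewrite rowsK.
Qed.

Lemma foata_preim_R_ge1 :
  Pstar `&` foata @^-1` words_of (conj_set R_ge1) = B [:: 2; 1].
Proof. by apply: preim_foata; [exact: conj_R_ge1_sub|exact: B21_sub_W21|exact: foata_B21]. Qed.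

Lemma foata_preim_P_neq1 :
  Pstar `&` foata @^-1` words_of (conj_set P_neq1) = W [:: 1; 2; 1].
Proof. by apply: preim_foata; [exact: conj_P_neq1_sub|exact: W121_sub_W21|exact: foata_W121]. Qed.

Lemma W21_binary v : W [:: 2; 1] v -> binary v.
Proof. by case/W21_decomp => [->|[x bx ->]] //; rewrite !binary_rcons. Qed.

Lemma foata_bij (S : set word) (T : set (seq nat)) : T `<=` P -> S `<=` W [:: 2; 1] ->
  Pstar `&` foata @^-1` words_of T = S -> set_bij S (words_of T) foata.
Proof.
move=> TP SW E; split.
- by move=> v; rewrite -E => -[].
- move=> v v'; rewrite !inE => /SW/W21_binary bv _; exact: foata_inj.
move=> w Tw; have [[la Pla wE] _] := (words_ofP w TP).1 Tw.
have bw : binary w by rewrite -wE binary_pword.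
have [v bv vE] := foata_surj bw; exists v => //.
by rewrite -E; split; [exact: binary_positive|rewrite /= vE].
Qed.

Lemma foata_mahonian (S : set word) (T : set (seq nat)) : T `<=` P -> S `<=` W [:: 2; 1] ->
  Pstar `&` foata @^-1` words_of T = S -> mahonian_pair S (words_of T).
Proof.
move=> TP SW E; split.
- by rewrite -E => v [].
- by move=> w [la _ <-]; apply: binary_positive; exact: binary_pword.
- exists foata; first exact: foata_bij.
  move=> v /SW/W21_binary bv; rewrite maj_foata // inv_rows //.
  by rewrite binary_foata.
Qed.

Lemma rows_foata_bij (S : set word) (T : set (seq nat)) : T `<=` P -> S `<=` W [:: 2; 1] ->
  Pstar `&` foata @^-1` words_of T = S -> set_bij S T (rows \o foata).
Proof.
move=> TP SW E; have [f1 f2 f3] := foata_bij TP SW E; split.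
- by move=> v /f1 /= /(words_ofP _ TP)[].
- move=> v v' Sv Sv' /= rE; apply: f2 => //.
  move: Sv Sv'; rewrite !inE => /f1[la /TP Pla laE] /f1[mu /TP Pmu muE].
  by move: rE; rewrite -laE -muE !rowsK // => ->.
- move=> la Tla; have [|v Sv vE] := f3 (pword la); first by exists la.
  by exists v => //=; rewrite vE rowsK //; exact: TP.
Qed.

Lemma des_cons1 v : all (leq 1) v -> des (1 :: v) = des v.
Proof. by case: v => // b v /andP[b0 _]; rewrite des_cons2 ltnNge b0. Qed.

Lemma maj_cons a v : maj (a :: v) = des (a :: v) + maj v.
Proof.
case: v => [|b v]; first by rewrite /maj big_nil.
rewrite des_cons2 /maj Des_cons2 big_cat big_map /des -addnA; congr (_ + _).
  by case: (b < a); rewrite ?big_seq1 ?big_nil.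
by under eq_bigr do rewrite -add1n; rewrite big_split /= sum1_size.
Qed.

(** * Raising the major index by one *)

(** The maximum of the heights of the path, including the initial height 0. In
    front of the path, a step 1 lowers all heights but the initial one, whence the
    truncated predecessor. *)
Fixpoint max_level (w : word) : nat :=
  if w is a :: w' then if a == 1 then (max_level w').-1 else (max_level w').+1 else 0.

Lemma max_level_le w c : binary w ->
  (forall k, (level (take k w) <= c%:Z)%R) <-> max_level w <= c.
Proof.
elim: w c => [|a w IH] c; first by split.
rewrite binary_cons => /andP[/orP[]/eqP-> bw] /=.
  have -> : (max_level w).-1 <= c <-> max_level w <= c.+1 by lia.
  have step x : (level [:: 1] + x <= c%:Z)%R = (x <= c.+1%:Z)%R.
    by rewrite /level /=; lia.
  rewrite -IH //; split=> [H k|H [|k]] //=; last by rewrite level_cons step.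
  by have := H k.+1; rewrite /= level_cons step.
have step x : (level [:: 2] + x <= c%:Z)%R = (x <= c%:Z - 1)%R.
  by rewrite /level /=; lia.
case: c step => [|c] step.
  by split=> // H; have := H 1; rewrite /= take0 -[level _]addr0 step.
have E : (c.+1%:Z - 1 = c%:Z)%R by lia.
rewrite ltnS -IH //; split=> [H k|H [|k]] //=; last by rewrite level_cons step E.
by have := H k.+1; rewrite /= level_cons step E.
Qed.

Lemma ballot_max_level w : binary w -> ballot w <-> max_level w = 0.
Proof.
move=> bw; have <- : max_level w <= 0 <-> max_level w = 0 by lia.
rewrite -max_level_le //; split=> H k; have := H k; rewrite ?level_le0 //.
Qed.

(** Turns into a 2 the step 1 that follows the last visit to the maximal height.
    This step is the first one exactly when it is a 1 and the remaining path
    never goes above its start. On the empty word, the step is the first of the implicit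
    final 1s. *)
Fixpoint raise (w : word) : word :=
  if w is a :: w' then
    if (a == 1) && (max_level w' == 0) then 2 :: w' else a :: raise w'
  else [:: 2].

(** Canonical representatives of binary words followed by infinitely many 1s:
    no trailing 1 is written. The default letter 2 lets in the empty word. *)
Definition trimmed : set word := [set w | binary w /\ last 2 w = 2].

Lemma raise_cons w : exists b s, raise w = b :: s.
Proof. by case: w => [|a w] /=; [|case: ifP]; do 2 eexists. Qed.

Lemma trimmed_cons a w : trimmed (a :: w) -> ((a == 1) || (a == 2)) /\ trimmed w.
Proof.
case; rewrite binary_cons => /andP[a12 bw] /= E; split=> //; split => //.
by case: w E {bw}.
Qed.

Lemma trimmed_cons2 w : trimmed w -> trimmed (2 :: w).
Proof. by case=> bw E; split. Qed.

Lemma trimmed_cons1 w : trimmed w -> w != [::] -> trimmed (1 :: w).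
Proof. by case: w => // b w [bw E] _; split. Qed.

Lemma trimmed_cons1_neq0 w : trimmed (1 :: w) -> w != [::].
Proof. by case: w => // -[]. Qed.

Lemma trimmed_raise w : trimmed w -> trimmed (raise w).
Proof.
elim: w => [|a w IH] //= Yw; have [a12 Yw'] := trimmed_cons Yw.
case: ifP => _; first exact: trimmed_cons2.
case/orP: a12 => /eqP->; first apply: trimmed_cons1; last exact/trimmed_cons2/IH.
  exact: IH.
by have [b [s ->]] := raise_cons w.
Qed.

Lemma max_level_raise w : max_level (raise w) = (max_level w).+1.
Proof.
elim: w => //= a w IH; have [a1|a1] /= := eqVneq a 1; last by rewrite (negbTE a1) IH.
have [t0|t0] /= := eqVneq (max_level w) 0; first by rewrite t0.
by rewrite a1 /= IH prednK // lt0n.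
Qed.

Lemma raise_inj w w' : trimmed w -> trimmed w' -> raise w = raise w' -> w = w'.
Proof.
elim: w w' => [|a w IH] [|a' w'] Yw Yw' //=.
- have [a12 _] := trimmed_cons Yw'; case: ifP => [/andP[/eqP E _] [E']|_ [_]].
    by move: Yw'; rewrite E -E' => /trimmed_cons1_neq0.
  by have [b [s ->]] := raise_cons w'.
- have [a12 _] := trimmed_cons Yw; case: ifP => [/andP[/eqP E _] [E']|_ [_]].
    by move: Yw; rewrite E E' => /trimmed_cons1_neq0.
  by have [b [s ->]] := raise_cons w.
have [a12 Yw1] := trimmed_cons Yw; have [a12' Yw1'] := trimmed_cons Yw'.
case: ifP => [/andP[/eqP-> /eqP tw]|_]; case: ifP => [/andP[/eqP-> /eqP tw']|_].
- by move=> [->].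
- by move=> [_ E]; move: tw; rewrite E max_level_raise.
- by move=> [_ E]; move: tw'; rewrite -E max_level_raise.
- by move=> [-> /IH ->].
Qed.

(** The preimage is found by turning into a 1 the step that first reaches the
    maximal height, and by removing this 1 if nothing follows it. *)
Lemma raise_surj y : trimmed y -> 0 < max_level y -> exists2 w, trimmed w & raise w = y.
Proof.
elim: y => // a y IH Yy; have [/orP[]/eqP Ea Yy'] := trimmed_cons Yy; rewrite {}Ea /= in Yy *.
  move=> ty; have [|w Yw E] := IH Yy'; first by lia.
  have tE := max_level_raise w; rewrite E in tE.
  exists (1 :: w); last by rewrite /= E; case: eqP => //; lia.
  by apply: trimmed_cons1 => //; case: w tE {Yw E} => //= tE; rewrite tE in ty.
move=> _; case: (posnP (max_level y)) => ty.
  case: y ty Yy' {IH Yy} => [_ _|b y ty Yy]; first by exists [::].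
  exists (1 :: b :: y); first exact: trimmed_cons1.
  by rewrite [LHS]/= -/(max_level (b :: y)) ty.
have [w Yw E] := IH Yy' ty.
by exists (2 :: w); [exact: trimmed_cons2|rewrite /= E].
Qed.

Lemma binary_pos_rcons w a : binary w -> 0 < a -> all (leq 1) (rcons w a).
Proof. by move=> /binary_positive pw a0; rewrite all_rcons a0. Qed.

Lemma des_cons21 v : des [:: 2, 1 & v] = (des (1 :: v)).+1.
Proof. by rewrite des_cons2. Qed.

Lemma des_cons22 v : des [:: 2, 2 & v] = des (2 :: v).
Proof. by rewrite des_cons2. Qed.

Lemma max_level0_cons y : trimmed y -> y != [::] -> max_level y = 0 -> exists w, y = 1 :: w.
Proof.
case: y => // a y /trimmed_cons[/orP[]/eqP-> _] _ //= _; by exists y.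
Qed.

(** The new 2 follows a 2 or starts the word, since a 1 would come down from a
    greater height; and it is followed by a 1, since a 2 would lead back to the
    maximal height. So the descent before it is moved one place to the right, and
    a descent is created only if the maximal height is never visited after the
    start. The two equalities feed each other in the induction. *)
Lemma des_raise w : trimmed w ->
  des (2 :: rcons (raise w) 1) = des (2 :: rcons w 1) /\
  (0 < max_level w -> des (rcons (raise w) 1) = des (rcons w 1)).
Proof.
elim: w => [|a w IH] // Yw; have [/orP[]/eqP Ea Yw'] := trimmed_cons Yw; rewrite {}Ea in Yw *.
  have [IH1 IH2] := IH Yw'.
  have pu : all (leq 1) (rcons (raise w) 1).
    by apply: binary_pos_rcons => //; case: (trimmed_raise Yw').
  have pw : all (leq 1) (rcons w 1) by apply: binary_pos_rcons => //; case: Yw'.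
  rewrite /=; case: eqP => [tw|/eqP tw].
    rewrite tw; split=> //.
    have [s ->] := max_level0_cons Yw' (trimmed_cons1_neq0 Yw) tw.
    by rewrite /= des_cons22 !des_cons21 !des_cons2.
  split=> [|tw1]; first by rewrite /= !des_cons21 !des_cons1 // IH2 // lt0n.
  by rewrite /= !des_cons1 // IH2 // lt0n.
have [IH1 IH2] := IH Yw'.
by split=> [|_] /=; rewrite ?des_cons22.
Qed.

(** The descent at the last visit to the maximal height moves one place to the
    right, or a descent at the first place is created. *)
Lemma maj_raise w : trimmed w -> maj (rcons (raise w) 1) = (maj (rcons w 1)).+1.
Proof.
elim: w => [|a w IH] // Yw.
  by rewrite /= !maj_cons [des [:: 1]]/= /maj big_nil.
have [/orP[]/eqP Ea Yw'] := trimmed_cons Yw; rewrite {}Ea in Yw *.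
  have pu : all (leq 1) (rcons (raise w) 1).
    by apply: binary_pos_rcons => //; case: (trimmed_raise Yw').
  have pw : all (leq 1) (rcons w 1) by apply: binary_pos_rcons => //; case: Yw'.
  rewrite /=; case: eqP => [tw|/eqP tw] /=; rewrite !(maj_cons, des_cons1) //.
    have [s ->] := max_level0_cons Yw' (trimmed_cons1_neq0 Yw) tw.
    by rewrite /= des_cons21.
  by rewrite IH // (des_raise Yw').2 ?lt0n // addnS.
by rewrite /= !maj_cons IH // (des_raise Yw').1 addnS.
Qed.

Lemma trimmed_rcons y : trimmed y -> y = [::] \/ exists2 x, binary x & y = rcons x 2.
Proof.
case; case/lastP: y => [|x a]; first by left.
by rewrite binary_rcons last_rcons => /andP[_ bx] ->; right; exists x.
Qed.

Lemma W21_trimmed v : W [:: 2; 1] v -> v != [::] -> exists2 y, trimmed y & v = rcons y 1.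
Proof.
case/W21_decomp => [->|[x bx ->]] // _; exists (rcons x 2) => //.
by split; rewrite ?binary_rcons ?last_rcons.
Qed.

Lemma trimmed_W21 y : trimmed y -> y != [::] -> W [:: 2; 1] (rcons y 1).
Proof.
case/trimmed_rcons => [->|[x bx ->]] // _; left; exists x => //.
by rewrite -!cats1 -catA.
Qed.

(** [raise] increases the maximal height by one, so its images are the words
    whose maximal height is positive, that is, the words that are not ballot
    sequences. *)
Lemma raise_bij : set_bij trimmed (W [:: 2; 1] `&` ~` B [:: 2; 1])
  (fun y => rcons (raise y) 1).
Proof.
have bal y : trimmed y -> ballot (rcons y 1) <-> max_level y = 0.
  case=> by_ _; rewrite ballot_peaks ?binary_rcons // peaks_rcons11.
  by rewrite -ballot_peaks // ballot_max_level.
split.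
- move=> y Yy; have [b [s E]] := raise_cons y; have Yu := trimmed_raise Yy; split.
    by apply: trimmed_W21 => //; rewrite E.
  by case=> _ /= /(bal _ Yu); rewrite max_level_raise.
- by move=> y y'; rewrite !inE => Yy Yy' /rcons_inj[]; exact: raise_inj.
- move=> v [Wv nB].
  have v0 : v != [::] by apply/eqP => E; apply: nB; rewrite E; split; [right|].
  have [y Yy vE] := W21_trimmed Wv v0.
  have [|w Yw wE] := raise_surj Yy; last by exists w => //; rewrite wE vE.
  by rewrite lt0n; apply/eqP => /(bal _ Yy) bv; apply: nB; split=> //; rewrite vE.
Qed.

Lemma rcons2_bij : set_bij trimmed (W [:: 2; 1] `&` ~` W [:: 1; 2; 1])
  (fun y => rcons (rcons y 2) 1).
Proof.
split.
- move=> y [by_ ly]; split; first by left; exists y => //; rewrite -!cats1 -catA.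
  by move/W121_rcons => []; rewrite ly.
- by move=> y y' _ _ /rcons_inj[] /rcons_inj[].
- move=> v [/W21_decomp[->|[x bx ->]] nW]; first by case: nW; right.
  exists x => //; split=> //.
  case/lastP: x bx nW => // x a; rewrite binary_rcons last_rcons => /andP[/orP[]/eqP-> bx] // [].
  by apply/W121_rcons; rewrite binary_rcons last_rcons.
Qed.

Lemma maj_rcons21 y : trimmed y -> maj (rcons (rcons y 2) 1) = (maj (rcons y 1)).+1.
Proof.
move=> Yy; rewrite maj_rcons2 maj_rcons_2; last by case: Yy.
case/trimmed_rcons: Yy => [->|[x bx ->]] /=; first by rewrite /maj big_nil.
by rewrite maj_rcons2 addnS size_rcons.
Qed.

(** * Counting by a statistic *)

Definition fibers_finite (T : Type) (S : set T) (s : T -> nat) :=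
  forall n, finite_set (S `&` [set v | s v = n]).

Definition count_by (T : choiceType) (S : set T) (s : T -> nat) : nat -> int :=
  formal_sum S (fun v => monomial (s v)).

Lemma finite_bounded_words m n : finite_set [set w : seq nat | size w <= n /\ all (geq m) w].
Proof.
apply: (@sub_finite_set _ _ ((fun t : n.-bseq 'I_m.+1 => map val t) @` setT)); last first.
  exact: finite_image.
move=> w [sw /allP mw] /=.
have sw' : size (map (fun x => inord x : 'I_m.+1) w) <= n by rewrite size_map.
exists (Bseq sw') => //=; rewrite -map_comp -[RHS]map_id.
by apply/eq_in_map => x /mw /= xm; rewrite inordK.
Qed.

Lemma finite_W21 : fibers_finite (W [:: 2; 1]) maj.
Proof.
move=> n; apply: sub_finite_set (finite_bounded_words 2 n.+1) => v [Wv /= <-].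
split; last by apply: sub_all (W21_binary Wv) => x /orP[]/eqP->.
case/W21_decomp: Wv => [->|[x bx ->]] //.
by rewrite maj_rcons2 !size_rcons /= ltnS leq_addl.
Qed.

Lemma finite_P : fibers_finite P sumn.
Proof.
move=> n; apply: sub_finite_set (finite_bounded_words n n) => la [/andP[_ pl] /= <-].
elim: la pl => //= p la IH /andP[p0 /IH[s a]]; split; first by lia.
by rewrite leq_addr; apply: sub_all a => x /= xl; lia.
Qed.

Lemma fibers_sub (T : Type) (S S' : set T) s :
  S `<=` S' -> fibers_finite S' s -> fibers_finite S s.
Proof. by move=> SS fS n; apply: sub_finite_set (fS n); exact: setSI. Qed.

Lemma count_byE (T : choiceType) (S : set T) s n :
  count_by S s n = (\sum_(v \in S `&` [set v | s v = n]) (1 : int))%R.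
Proof.
rewrite fsbig_mkcondr; apply: eq_fsbigr => v _; rewrite /monomial.
case: ifPn; rewrite ?inE /=; first by move=> ->; rewrite eqxx.
by rewrite notin_setE /= eq_sym => /eqP/negbTE->.
Qed.

Lemma count_split (T : choiceType) (S A : set T) s n : fibers_finite S s ->
  (count_by S s n = count_by (S `&` A) s n + count_by (S `&` ~` A) s n)%R.
Proof.
by move=> fS; rewrite !count_byE (fsbigID A) //; congr (_ + _)%R; rewrite setIAC.
Qed.

Lemma count_bij (T T' : choiceType) (S : set T) (S' : set T') h s s' : set_bij S S' h ->
  (forall v, S v -> s' (h v) = s v) -> count_by S s = count_by S' s'.
Proof.
move=> hb E; apply/funext => n; rewrite /count_by /formal_sum (reindex_fsbig _ _ _ _ hb).
by apply: eq_fsbigr => v; rewrite inE => /E ->.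
Qed.

Lemma count_shift (T T' : choiceType) (S : set T) (S' : set T') h s s' k n :
  set_bij S S' h ->
  (forall v, S v -> s' (h v) = k + s v) ->
  count_by S' s' n = if k <= n then count_by S s (n - k) else 0%R.
Proof.
move=> hb E; rewrite /count_by /formal_sum (reindex_fsbig _ _ _ _ hb).
case: leqP => kn; last rewrite fsbig1 //.
  apply: eq_fsbigr => v; rewrite inE => /E ->; rewrite /monomial.
  by rewrite -{1}(subnKC kn) eqn_add2l.
by move=> v /E ->; rewrite /monomial; case: eqP => // ?; lia.
Qed.

(** Both counts are the count over W_21 minus its shift by one: the complements
    are images of the same set [trimmed] under maps with the same effect on
    maj. *)
Lemma count_B21_W121 : count_by (B [:: 2; 1]) maj = count_by (W [:: 1; 2; 1]) maj.
Proof.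
apply/funext => n.
have H S h : S `<=` W [:: 2; 1] -> set_bij trimmed (W [:: 2; 1] `&` ~` S) h ->
    (forall y, trimmed y -> maj (h y) = (1 + maj (rcons y 1))) ->
    (count_by S maj n = count_by (W [:: 2; 1]) maj n -
      (if (1 <= n)%N then count_by trimmed (fun y => maj (rcons y 1)) (n - 1)%N else 0))%R.
  move=> SW hb E; rewrite (count_split S _ finite_W21) (setIidr SW).
  by rewrite (count_shift n hb E) addrK.
rewrite (H _ _ B21_sub_W21 raise_bij); last by move=> y /maj_raise.
by rewrite (H _ _ W121_sub_W21 rcons2_bij) // => y /maj_rcons21.
Qed.

(** * The product formula *)

Definition parts_in (M : nat) : set (seq nat) :=
  [set la | P la /\ all (fun x => 1 < x < M) la].

Lemma parts_in_sub M : parts_in M `<=` P. Proof. by move=> la []. Qed.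

(** A part [M] that is the largest allowed one can only be removed from, or
    added at, the head. *)
Lemma cons_max_part_bij M : 1 < M ->
  set_bij (parts_in M.+1) (parts_in M.+1 `&` ~` parts_in M) (cons M).
Proof.
move=> M1; split.
- move=> la [/andP[sl pl] al]; split; last by move=> [_ /= /andP[]]; rewrite ltnn andbF.
  split; last by rewrite /= M1 ltnSn al.
  apply/andP; split; last by apply/andP; split=> //; exact: ltnW.
  by rewrite sorted_geq_cons sl andbT; apply: sub_all al => x /= /andP[_]; rewrite ltnS.
- by move=> la mu _ _ [].
- move=> [|p la] [[Pl al] nl]; first by case: nl.
  have /andP[] := Pl; rewrite sorted_geq_cons => /andP[pla sla] /andP[p0 la0].
  have /andP[/andP[p1 pM] ala] := al.
  have [pE|pM'] := eqVneq p M.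
    exists la; last by rewrite pE.
    by split=> //; apply/andP.
  case: nl; split=> //; have {pM'}pM' : p < M by rewrite ltn_neqAle pM'.
  rewrite /= p1 pM' /=; apply/allP => x xl.
  by have /andP[-> _] := allP ala _ xl; rewrite (leq_ltn_trans (allP pla _ xl)).
Qed.

Definition parts_gf (M : nat) : fps := Fps (count_by (parts_in M) sumn).

Lemma coef_qX_mul k (f : fps) n :
  coef (qX k * f)%R n = if k <= n then coef f (n - k) else 0%R.
Proof.
have -> : coef (qX k * f)%R n =
   (\sum_(j < n.+1) ((j == k :> nat)%:R * coef f (n - j)%N))%R by [].
case: leqP => kn.
  rewrite (bigD1 (Ordinal (kn : k < n.+1))) //= eqxx mul1r big1 ?addr0 // => j.
  by rewrite -val_eqE /= => /negbTE->; rewrite mul0r.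
by rewrite big1 // => j _; rewrite ltn_eqF ?mul0r // (leq_ltn_trans _ kn) // -ltnS.
Qed.

Lemma parts_gf_rec M : 1 < M -> ((1 - qX M) * parts_gf M.+1 = parts_gf M)%R.
Proof.
move=> M1; apply/fpsP => n; rewrite mulrBl mul1r.
have -> : coef (parts_gf M.+1 - qX M * parts_gf M.+1)%R n =
  (coef (parts_gf M.+1) n - coef (qX M * parts_gf M.+1) n)%R by [].
rewrite coef_qX_mul /=.
rewrite (count_split (parts_in M)); last exact: fibers_sub (@parts_in_sub _) finite_P.
rewrite -(@count_shift _ _ _ _ _ _ sumn M n (cons_max_part_bij M1)) //.
rewrite addrK; congr (count_by _ _ _); apply: setIidr => la [Pl al]; split=> //.
by apply: sub_all al => x /andP[-> /ltnW].
Qed.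

Lemma parts_gf2 : parts_gf 2 = 1%R.
Proof.
apply/fpsP => n /=; rewrite /count_by /formal_sum.
have -> : parts_in 2 = [set [::]].
  apply/seteqP; split=> [[|p la] [_ /=]|la ->] //; first by case: p => [|[]].
by rewrite fsbig_set1.
Qed.

Lemma prod_parts_gf M : 1 < M -> (\prod_(2 <= i < M) (1 - qX i)^-1 = parts_gf M)%R.
Proof.
case: M => [|[|M]] // _; elim: M => [|M IH]; first by rewrite big_geq // parts_gf2.
rewrite big_nat_recr //= IH -(@parts_gf_rec M.+2) // mulrC mulKr //.
exact: unit_one_sub_qX.
Qed.

Lemma count_W121 : count_by (W [:: 1; 2; 1]) maj = count_by P_neq1 sumn.
Proof.
have hb := rows_foata_bij conj_P_neq1_sub W121_sub_W21 foata_preim_P_neq1.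
rewrite (count_bij (s' := sumn) hb).
  apply/esym/(count_bij (h := conjugate)) => [|la [Pl _]]; last exact: sumn_conj.
  split=> [la Pl|la mu|la [mu Pm <-]]; first by exists la.
    by rewrite !inE => -[Pl _] [Pm _] /(congr1 conjugate); rewrite !conjK.
  by exists mu.
by move=> v /W121_sub_W21/W21_binary bv /=; rewrite maj_foata.
Qed.

Lemma coef_parts_gf M n : n < M -> coef (parts_gf M) n = count_by P_neq1 sumn n.
Proof.
move=> nM; rewrite /= !count_byE; apply: eq_fsbigl; apply/seteqP; split=> la.
  case=> [[Pl al] sn]; split=> //; split=> //.
  by apply/negP => /(allP al).
case=> [[Pl n1] /= sn]; split=> //; split=> //; apply/allP => x xl.
have /andP[_ /allP/(_ _ xl) x0] := Pl.
have x1 : x != 1 by apply: contraNneq n1 => <-.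
rewrite ltn_neqAle eq_sym x1 x0 /=; apply: leq_ltn_trans nM; rewrite -sn.
by elim: la xl {Pl n1 sn} => //= p la IH; rewrite inE => /predU1P[->|/IH]; lia.
Qed.

(** * The theorem *)

Lemma fibers_summable (T : choiceType) (X : eqType) (S : set T) (s : T -> nat)
    (F : T -> X) (p : X -> nat) :
  fibers_finite S s -> (forall v, p (F v) = s v) ->
  formally_summable S (fun v => monomial (F v)).
Proof.
move=> fS pF x; apply: sub_finite_set (fS (p x)) => v [Sv /=].
rewrite /monomial; have [-> _|_] := eqVneq x (F v); last by rewrite eqxx.
split=> //=.
Qed.

Local Open Scope ring_scope.

Theorem theorem5p3 :
  [/\ Pstar `&` foata @^-1` words_of P = W [:: 2; 1],
      Pstar `&` foata @^-1` words_of (conj_set R_ge1) = B [:: 2; 1] &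
      Pstar `&` foata @^-1` words_of (conj_set P_neq1) = W [:: 1; 2; 1]]%N
  /\
  [/\ mahonian_pair (W [:: 2; 1]) (words_of P),
      mahonian_pair (B [:: 2; 1]) (words_of (conj_set R_ge1)) &
      mahonian_pair (W [:: 1; 2; 1]) (words_of (conj_set P_neq1))]%N
  /\
  (forall (S : set word) (T : set (seq nat)),
     [\/ S = W [:: 2; 1]%N /\ T = P,
         S = B [:: 2; 1]%N /\ T = conj_set R_ge1 |
         S = W [:: 1; 2; 1]%N /\ T = conj_set P_neq1] ->
     let F (v : word) : nat * nat * int -> int :=
       monomial (X := (nat * nat * int)%type) (maj v, des v, e v) in
     let G (la : seq nat) : nat * nat * int -> int :=
       monomial (X := (nat * nat * int)%type) (sumn la, durfee la, r la + 1) in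
     [/\ formally_summable S F, formally_summable T G &
         formal_sum S F = formal_sum T G])
  /\
  (let F (w : word) : nat -> int := monomial (maj w) in
   [/\ formally_summable (B [:: 2; 1]%N) F,
       formally_summable (W [:: 1; 2; 1]%N) F,
       formal_sum (B [:: 2; 1]%N) F = formal_sum (W [:: 1; 2; 1]%N) F &
       infinite_prod 2 (fun i => (1 - qX i)^-1)
         (Fps (formal_sum (W [:: 1; 2; 1]%N) F))]).
Proof.
split; first by rewrite foata_preim_P foata_preim_R_ge1 foata_preim_P_neq1.
split.
  split; first exact: foata_mahonian foata_preim_P.
    exact: foata_mahonian conj_R_ge1_sub B21_sub_W21 foata_preim_R_ge1.
  exact: foata_mahonian conj_P_neq1_sub W121_sub_W21 foata_preim_P_neq1.
split=> [S T ST F G|F].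
  have [TP SW] : T `<=` P /\ S `<=` W [:: 2; 1]%N.
    case: ST => -[-> ->]; split=> //.
    - exact: conj_R_ge1_sub.
    - exact: B21_sub_W21.
    - exact: conj_P_neq1_sub.
    - exact: W121_sub_W21.
  have preim : Pstar `&` foata @^-1` words_of T = S.
    case: ST => -[-> ->].
    - exact: foata_preim_P.
    - exact: foata_preim_R_ge1.
    - exact: foata_preim_P_neq1.
  split.
  - apply: (@fibers_summable _ _ _ maj _ (fun x => x.1.1)) => //.
    exact: fibers_sub SW finite_W21.
  - apply: (@fibers_summable _ _ _ sumn _ (fun x => x.1.1)) => //.
    exact: fibers_sub TP finite_P.
  - apply/funext => x; rewrite /formal_sum (reindex_fsbig _ _ _ _ (rows_foata_bij TP SW preim)).
    apply: eq_fsbigr => v; rewrite inE => /SW Wv; have bv := W21_binary Wv.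
    by rewrite /F /G /= maj_foata // durfee_foata // e_foata.
split.
- by apply: (@fibers_summable _ _ _ maj _ id) => //; exact: fibers_sub B21_sub_W21 finite_W21.
- by apply: (@fibers_summable _ _ _ maj _ id) => //; exact: fibers_sub W121_sub_W21 finite_W21.
- exact: count_B21_W121.
- (* [M > n] lets in all parts of a partition of [n]; [M > 1] starts the product *)
  move=> n; exists n.+2 => M nM; have nM' : (n < M)%N by exact: ltnW.
  rewrite prod_parts_gf ?(leq_trans _ nM) // coef_parts_gf // -count_W121 //.
Qed.
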